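(* Let $\mathcal A$ be a skew monoidal category and $\mathbb A$ the corresponding left representable skew multicategory, so that $\mathcal A$ is the skew monoidal category of tight unary maps of $\mathbb A$. Given a braiding on $\mathbb A$, let $s_{A,B,C}\colon (AB)C\to (AC)B$ be the unique natural isomorphism such that, under the natural isomorphisms $\mathcal A((AC)B,D)\cong\mathbb A_t(A,C,B;D)$ and $\mathcal A((AB)C,D)\cong\mathbb A_t(A,B,C;D)$ given by left representability, precomposition with $s_{A,B,C}$ corresponds to the action $\beta_2^*\colon\mathbb A_t(A,C,B;D)\to\mathbb A_t(A,B,C;D)$, $g\mapsto g\beta_2$. Then this assignment defines a bijection between braidings on $\mathbb A$ and braidings on $\mathcal A$, which restricts to a bijection between symmetries on $\mathbb A$ and symmetries on $\mathcal A$.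
   Context: **Skew monoidal categories.** A skew monoidal category is a category with a functor $(X,Y)\mapsto XY$, an object $I$ and natural transformations (not necessarily invertible) $a_{X,Y,Z}\colon (XY)Z\to X(YZ)$, $\ell_X\colon IX\to X$, $r_X\colon X\to XI$ such that $a_{A,B,CD}\,a_{AB,C,D}=(1_A a_{B,C,D})\,a_{A,BC,D}\,(a_{A,B,C}1_D)$; $\ell_{AB}\,a_{I,A,B}=\ell_A1_B$; $(1_A\ell_B)\,a_{A,I,B}\,(r_A1_B)=1_{AB}$; $a_{A,B,I}\,r_{AB}=1_Ar_B$; $\ell_I r_I=1_I$. A braiding on it is a natural isomorphism $s_{X,A,B}\colon (XA)B\to (XB)A$ such that (B1) $s_{XC,A,B}(s_{X,A,C}1_B)s_{XA,B,C}=(s_{X,B,C}1_A)s_{XB,A,C}(s_{X,A,B}1_C)$; (B2) $s_{X,A,BC}\,a_{XA,B,C}=(a_{X,B,C}1_A)s_{XB,A,C}(s_{X,A,B}1_C)$; (B3) $s_{X,AB,C}(a_{X,A,B}1_C)=a_{XC,A,B}(s_{X,A,C}1_B)s_{XA,B,C}$; (B4) $(1_Xs_{A,B,C})\,a_{X,AB,C}(a_{X,A,B}1_C)=a_{X,AC,B}(a_{X,A,C}1_B)s_{XA,B,C}$. It is a symmetry if moreover $s_{X,B,A}s_{X,A,B}=1$. **Skew multicategories.** A skew multicategory $\mathbb A$ consists of a multicategory $\mathbb A_\ell$ (whose multimaps, possibly nullary, are called loose), together with: for each non-empty list $\overline a$ of objects and each object $b$ a set $\mathbb A_t(\overline a;b)$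 of tight multimaps with a function $j\colon\mathbb A_t(\overline a;b)\to\mathbb A_\ell(\overline a;b)$; elements $1_a\in\mathbb A_t(a;a)$ sent by $j$ to the identities of $\mathbb A_\ell$; and substitution maps $\mathbb A_t(b_1,\dots,b_n;c)\times\mathbb A_t(\overline a_1;b_1)\times\prod_{i=2}^n\mathbb A_\ell(\overline a_i;b_i)\to\mathbb A_t(\overline a_1,\dots,\overline a_n;c)$, satisfying the evident associativity and identity axioms, with $j$ respecting substitution. Write $g\circ_i f$ for substitution of $f$ in the $i$th place of $g$ (identities elsewhere; $j$ is applied where a loose map is needed): it is tight if $g$ is tight and either $i\ge2$ or $f$ is tight. $\mathcal A$ denotes the category with $\mathcal A(a,b)=\mathbb A_t(a;b)$. **Left representability.** $\mathbb A$ is weakly representable if for $x\in\{t,\ell\}$ and each list $\overline a$ (non-empty if $x=t$) the functor $\mathbb A_x(\overline a;-)\colon\mathcal A\to\mathbf{Set}$ is representable, by an object $m_x\overline a$ and universal multimap $\theta_x(\overline a)\in\mathbb A_x(\overline a;m_x\overline a)$. It is left representable if moreover all functions $-\circ_1\theta_x(\overline a)\colon\mathbb A_t(m_x\overline a,\overline b;c)\to\mathbb A_x(\overline a,\overline b;c)$ are bijections. Then $\mathcal A$ is skew monoidal: $AB=m_t(A,B)$ with universal tight map $e\colon A,B\to AB$; $fg$ is determined by $fg\circ_1e=e(f,g)$; $a_{A,B,C}$ is the unique tight unary map with $a_{A,B,C}\circ_1e_{AB,C}\circ_1e_{A,B}=e_{A,BC}\circ_2e_{B,C}$; $I$ represents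 $\mathbb A_\ell(\,;-)$ with universal nullary $u$; $\ell_A\colon IA\to A$ is the unique tight map with $\ell_A\circ_1(e_{I,A}\circ_1u)=j(1_A)$; and $r_A=e_{A,I}\circ_2u$. (This gives an equivalence between left representable skew multicategories and skew monoidal categories, which is the correspondence referred to in the claim.) **Braidings on skew multicategories.** A braiding on $\mathbb A$ consists of invertible assignments $g\mapsto g\beta_j$, sending $\mathbb A_\ell(a_1,\dots,a_m;b)\to\mathbb A_\ell(a_1,\dots,a_{j+1},a_j,\dots,a_m;b)$ for $1\le j<m$ and sending $\mathbb A_t(a_1,\dots,a_m;b)\to\mathbb A_t(a_1,\dots,a_{j+1},a_j,\dots,a_m;b)$ for $1<j<m$, such that $j(g\beta_i)=j(g)\beta_i$; the braid relations hold, $g\beta_i\beta_k=g\beta_k\beta_i$ for $k<i-1$ and $g\beta_i\beta_{i+1}\beta_i=g\beta_{i+1}\beta_i\beta_{i+1}$; and for $f$ of arity $n$, whenever both sides are meaningful (for tight or loose $f,g$), $g\circ_i(f\beta_j)=(g\circ_if)\beta_{i+j-1}$ and $g\beta_j\circ_if=(g\circ_if)\beta_j$ if $j<i-1$; $=(g\circ_{i-1}f)\beta_{j+n-1}\cdots\beta_j$ if $j=i-1$; $=(g\circ_{i+1}f)\beta_j\cdots\beta_{j+n-1}$ if $j=i$; $=(g\circ_if)\beta_{j+n-1}$ if $j>i$. (Operators act on the right, the leftmost first. Equivalently: the Artin braid groups act on loose multimaps and the subgroups $\langle\beta_2,\dots,\beta_{n-1}\rangle$ on tight $n$-ary multimaps,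 compatibly with $j$ and equivariantly for substitution.) The braiding is a symmetry if braids with the same underlying permutation act in the same way, equivalently if $g\beta_j\beta_j=g$ whenever defined. *)

(* Defs.v *)
From mathcomp Require Import all_boot.

Set Implicit Arguments.
Unset Strict Implicit.
Unset Printing Implicit Defensive.

Record category := Category {
  ob :> Type;
  hom : ob -> ob -> Type;
  idc : forall a, hom a a;
  comp : forall a b c, hom b c -> hom a b -> hom a c;
  comp_idl : forall a b (f : hom a b), comp (idc b) f = f;
  comp_idr : forall a b (f : hom a b), comp f (idc a) = f;
  comp_assoc : forall a b c d (h : hom c d) (g : hom b c) (f : hom a b),
    comp (comp h g) f = comp h (comp g f)
}.

Arguments hom {_} _ _.
Arguments idc {_} _.
Arguments comp {_ _ _ _} _ _.

Declare Scope cat_scope.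
Delimit Scope cat_scope with cat.
Local Open Scope cat_scope.

Notation "g ∘ f" := (comp g f) (at level 40, left associativity) : cat_scope.

Definition is_iso (C : category) (a b : C) (f : hom a b) : Prop :=
  exists g : hom b a, g ∘ f = idc a /\ f ∘ g = idc b.

Record skew_monoidal (C : category) := SkewMonoidal {
  tens : C -> C -> C;
  tensm : forall a a' b b', hom a a' -> hom b b' -> hom (tens a b) (tens a' b');
  unit_ob : C;
  assoc : forall a b c, hom (tens (tens a b) c) (tens a (tens b c));
  lunit : forall a, hom (tens unit_ob a) a;
  runit : forall a, hom a (tens a unit_ob);
  tensm_id : forall a b, tensm (idc a) (idc b) = idc (tens a b);
  tensm_comp : forall a a' a'' b b' b'' (f' : hom a' a'') (f : hom a a')
      (g' : hom b' b'') (g : hom b b'),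
    tensm (f' ∘ f) (g' ∘ g) = tensm f' g' ∘ tensm f g;
  assoc_nat : forall a a' b b' c c'
      (f : hom a a') (g : hom b b') (h : hom c c'),
    tensm f (tensm g h) ∘ assoc a b c = assoc a' b' c' ∘ tensm (tensm f g) h;
  lunit_nat : forall a a' (f : hom a a'),
    f ∘ lunit a = lunit a' ∘ tensm (idc unit_ob) f;
  runit_nat : forall a a' (f : hom a a'),
    tensm f (idc unit_ob) ∘ runit a = runit a' ∘ f;
  assoc_pentagon : forall a b c d,
    assoc a b (tens c d) ∘ assoc (tens a b) c d =
    tensm (idc a) (assoc b c d) ∘ assoc a (tens b c) d
      ∘ tensm (assoc a b c) (idc d);
  lunit_assoc : forall a b,
    lunit (tens a b) ∘ assoc unit_ob a b = tensm (lunit a) (idc b);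
  mid_unit : forall a b,
    tensm (idc a) (lunit b) ∘ assoc a unit_ob b ∘ tensm (runit a) (idc b) =
    idc (tens a b);
  assoc_runit : forall a b,
    assoc a b unit_ob ∘ runit (tens a b) = tensm (idc a) (runit b);
  lunit_runit : lunit unit_ob ∘ runit unit_ob = idc unit_ob
}.

Arguments unit_ob {_} _.
Arguments assoc {_} _ _ _ _.
Arguments lunit {_} _ _.
Arguments runit {_} _ _.

Section SkewBraiding.
Variables (C : category) (A : skew_monoidal C).
Local Notation "a ⊗ b" := (tens A a b) (at level 38, left associativity).
Local Notation "f ⊠ g" := (tensm A f g) (at level 38, left associativity).

Record swap_iso := SwapIso {
  swap_map :> forall x a b : C, hom (x ⊗ a ⊗ b) (x ⊗ b ⊗ a);
  swap_nat : forall x x' a a' b b' (f : hom x x') (g : hom a a') (h : hom b b'),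
    (f ⊠ h ⊠ g) ∘ swap_map x a b = swap_map x' a' b' ∘ (f ⊠ g ⊠ h);
  swap_invertible : forall x a b, is_iso (swap_map x a b)
}.

Record skew_braiding := SkewBraiding {
  braid_swap :> swap_iso;
  skew_B1 : forall x a b c, let s := braid_swap in
    s (x ⊗ c) a b ∘ (s x a c ⊠ idc b) ∘ s (x ⊗ a) b c =
    (s x b c ⊠ idc a) ∘ s (x ⊗ b) a c ∘ (s x a b ⊠ idc c);
  skew_B2 : forall x a b c, let s := braid_swap in
    s x a (b ⊗ c) ∘ assoc A (x ⊗ a) b c =
    (assoc A x b c ⊠ idc a) ∘ s (x ⊗ b) a c ∘ (s x a b ⊠ idc c);
  skew_B3 : forall x a b c, let s := braid_swap in
    s x (a ⊗ b) c ∘ (assoc A x a b ⊠ idc c) =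
    assoc A (x ⊗ c) a b ∘ (s x a c ⊠ idc b) ∘ s (x ⊗ a) b c;
  skew_B4 : forall x a b c, let s := braid_swap in
    (idc x ⊠ s a b c) ∘ assoc A x (a ⊗ b) c ∘ (assoc A x a b ⊠ idc c) =
    assoc A x (a ⊗ c) b ∘ (assoc A x a c ⊠ idc b) ∘ s (x ⊗ a) b c
}.

Definition is_skew_symmetry (s : skew_braiding) : Prop :=
  forall x a b, s x b a ∘ s x a b = idc (x ⊗ a ⊗ b).

Definition skew_symmetry := {s : skew_braiding | is_skew_symmetry s}.

End SkewBraiding.

Definition cast (O : Type) (X : seq O -> Type) (s s' : seq O) (e : s = s')
  (x : X s) : X s' := eq_rect s X x s' e.

(** [fam R [:: x1; ..; xn] [:: y1; ..; yn]] is [R x1 y1 * .. * R xn yn]; it is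
    empty when the two lists have different lengths. *)
Fixpoint fam (X Y : Type) (R : X -> Y -> Type) (xs : seq X) (ys : seq Y) :
    Type :=
  match xs, ys with
  | [::], [::] => unit
  | x :: xs', y :: ys' => (R x y * fam R xs' ys')%type
  | _, _ => Empty_set
  end.

Fixpoint fam_cat (X Y : Type) (R : X -> Y -> Type) xs ys xs' ys' :
    fam R xs ys -> fam R xs' ys' -> fam R (xs ++ xs') (ys ++ ys') :=
  match xs, ys
    return fam R xs ys -> fam R xs' ys' -> fam R (xs ++ xs') (ys ++ ys') with
  | [::], [::] => fun _ fs' => fs'
  | _ :: _, _ :: _ => fun fs fs' => (fs.1, fam_cat fs.2 fs')
  | _, _ => fun fs _ => match fs with end
  end.

Fixpoint fam_flatten (X Y : Type) (R : X -> Y -> Type) xss yss :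
    fam (fam R) xss yss -> fam R (flatten xss) (flatten yss) :=
  match xss, yss
    return fam (fam R) xss yss -> fam R (flatten xss) (flatten yss) with
  | [::], [::] => fun fs => fs
  | _ :: _, _ :: _ => fun fs => fam_cat fs.1 (fam_flatten fs.2)
  | _, _ => fun fs => match fs with end
  end.

Fixpoint fam_id (O : Type) (R : seq O -> O -> Type)
    (id : forall b, R [:: b] b) (bs : seq O) :
    fam R [seq [:: b] | b <- bs] bs :=
  match bs with
  | [::] => tt
  | b :: bs' => (id b, fam_id id bs')
  end.

Fixpoint fam_sub (O : Type) (R : seq O -> O -> Type)
    (sub : forall bs c, R bs c -> forall ass, fam R ass bs -> R (flatten ass) c)
    ass bs asss :
    fam R ass bs -> fam (fam R) asss ass -> fam R (map flatten asss) bs :=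
  match ass, bs, asss
    return fam R ass bs -> fam (fam R) asss ass -> fam R (map flatten asss) bs
  with
  | [::], [::], [::] => fun _ _ => tt
  | _ :: _, _ :: _, _ :: _ => fun fs hs =>
      (sub _ _ fs.1 _ hs.1, fam_sub sub fs.2 hs.2)
  | _ :: _, _ :: _, [::] => fun _ hs => match hs with end
  | [::], [::], _ :: _ => fun _ hs => match hs with end
  | [::], _ :: _, _ => fun fs _ => match fs with end
  | _ :: _, [::], _ => fun fs _ => match fs with end
  end.

Section ListEqualities.
Variable O : Type.
Implicit Types p q r s : seq O.

Lemma flatten_flatten (sss : seq (seq (seq O))) :
  flatten (flatten sss) = flatten (map flatten sss).
Proof. by elim: sss => //= ss sss <-; rewrite flatten_cat. Qed.

Lemma cat_flatten_flatten s (ss : seq (seq O)) sss :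
  s ++ flatten (ss ++ flatten sss) =
  (s ++ flatten ss) ++ flatten (map flatten sss).
Proof. by rewrite flatten_cat flatten_flatten catA. Qed.

Lemma flatten_insert p s q :
  flatten ([seq [:: x] | x <- p] ++ s :: [seq [:: x] | x <- q]) = p ++ s ++ q.
Proof. by rewrite flatten_cat /= !flatten_seq1. Qed.

Lemma cat_flatten_seq1 s q : s ++ flatten [seq [:: x] | x <- q] = s ++ q.
Proof. by rewrite flatten_seq1. Qed.

Lemma cat_inner p r s q : p ++ (r ++ s) ++ q = (p ++ r) ++ (s ++ q).
Proof. by rewrite !catA. Qed.

Lemma cat_outer p r q s : p ++ r ++ q ++ s = (p ++ r ++ q) ++ s.
Proof. by rewrite !catA. Qed.

Lemma nil_eq (e : [::] = [::] :> seq O) : e = erefl.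
Proof.
exact: (match e as e' in _ = s
          return match s return [::] = s -> Prop with
                 | [::] => fun e => e = erefl
                 | _ => fun=> True
                 end e' with erefl => erefl end).
Qed.

End ListEqualities.

(** In [lsub_assoc], [hs] consists of one list of multimaps for each member of
    [fs], to be substituted into that member. *)
Record multicategory := Multicategory {
  mob : Type;
  loose : seq mob -> mob -> Type;
  lid : forall a, loose [:: a] a;
  lsub : forall bs c, loose bs c ->
    forall ass, fam loose ass bs -> loose (flatten ass) c;
  lsub_idr : forall bs c (g : loose bs c),
    cast (X := loose^~ c) (flatten_seq1 bs) (lsub g (fam_id lid bs)) = g;
  lsub_idl : forall s b (f : loose s b),
    cast (X := loose^~ b) (cats0 s)
      (lsub (lid b) (ass := [:: s]) (f, tt)) = f;
  lsub_assoc : forall bs c ass asss (g : loose bs c) (fs : fam loose ass bs)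
      (hs : fam (fam loose) asss ass),
    cast (X := loose^~ c) (flatten_flatten asss)
      (lsub (lsub g fs) (fam_flatten hs)) =
    lsub g (fam_sub lsub fs hs)
}.

Arguments loose {_} _ _.
Arguments lid {_} _.
Arguments lsub {_ _ _} _ {_} _.

(** The list of sources of a tight multimap is non-empty: [tight a s b] is the
    set of tight multimaps with sources [a :: s] and target [b]. *)
Record skew_multicategory := SkewMulticategory {
  loose_part :> multicategory;
  tight : mob loose_part -> seq (mob loose_part) -> mob loose_part -> Type;
  forget : forall a s b, tight a s b -> loose (a :: s) b;
  tid : forall a, tight a [::] a;
  tsub : forall b bs c, tight b bs c -> forall a s, tight a s b ->
    forall ass, fam loose ass bs -> tight a (s ++ flatten ass) c;
  forget_tid : forall a, forget (tid a) = lid a;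
  forget_tsub : forall b bs c (g : tight b bs c) a s (f : tight a s b) ass
      (fs : fam loose ass bs),
    forget (tsub g f fs) =
    lsub (forget g) (ass := (a :: s) :: ass) (forget f, fs);
  tsub_idr : forall b bs c (g : tight b bs c),
    cast (X := (tight b)^~ c) (flatten_seq1 bs)
      (tsub g (tid b) (fam_id lid bs)) = g;
  tsub_idl : forall a s b (f : tight a s b),
    cast (X := (tight a)^~ b) (cats0 s)
      (tsub (tid b) f (ass := [::]) tt) = f;
  tsub_assoc : forall c cs d (g : tight c cs d) b bs (f : tight b bs c)
      css (fs : fam loose css cs)
      a s (h : tight a s b) ass (hs : fam loose ass bs)
      asss (hss : fam (fam loose) asss css),
    cast (X := (tight a)^~ d) (cat_flatten_flatten s ass asss)
      (tsub (tsub g f fs) h (fam_cat hs (fam_flatten hss))) =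
    tsub g (tsub f h hs) (fam_sub (@lsub _) fs hss)
}.

Arguments tight {_} _ _ _.
Arguments forget {_ _ _ _} _.
Arguments tid {_} _.
Arguments tsub {_ _ _ _} _ {_ _} _ {_} _.

Section SubstitutionInOnePlace.
Variable M : skew_multicategory.
Implicit Types (a b c : mob M) (p q s : seq (mob M)).

Definition lsub_at c p b q s (g : loose (p ++ b :: q) c) (f : loose s b) :
    loose (p ++ s ++ q) c :=
  cast (X := loose^~ c) (flatten_insert p s q)
    (lsub g (fam_cat (fam_id lid p)
       ((f, fam_id lid q) : fam _ (s :: [seq [:: x] | x <- q]) (b :: q)))).

(** Substitution in the first place of a tight multimap. *)
Definition tsub_head c b q a s (g : tight b q c) (f : tight a s b) :
    tight a (s ++ q) c :=
  cast (X := (tight a)^~ c) (cat_flatten_seq1 s q) (tsub g f (fam_id lid q)).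

(** Substitution in a later place of a tight multimap. *)
Definition tsub_at a c p b q s (g : tight a (p ++ b :: q) c) (f : loose s b) :
    tight a (p ++ s ++ q) c :=
  cast (X := (tight a)^~ c) (flatten_insert p s q)
    (tsub g (tid a) (fam_cat (fam_id lid p)
       ((f, fam_id lid q) : fam _ (s :: [seq [:: x] | x <- q]) (b :: q)))).

End SubstitutionInOnePlace.

Section TightCategory.
Variable M : skew_multicategory.

Definition tight_comp (a b c : mob M) (g : tight b [::] c) (f : tight a [::] b) :
    tight a [::] c :=
  tsub g f (ass := [::]) tt.

Lemma tight_comp_idl a b (f : tight a [::] b) : tight_comp (tid b) f = f.
Proof. by rewrite -[RHS]tsub_idl (nil_eq (cats0 [::])). Qed.

Lemma tight_comp_idr a b (f : tight a [::] b) : tight_comp f (tid a) = f.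
Proof. by rewrite -[RHS]tsub_idr (nil_eq (flatten_seq1 [::])). Qed.

Lemma tight_comp_assoc a b c d (h : tight c [::] d) (g : tight b [::] c)
    (f : tight a [::] b) :
  tight_comp (tight_comp h g) f = tight_comp h (tight_comp g f).
Proof.
have := @tsub_assoc M _ _ _ h _ _ g [::] tt _ _ f [::] tt [::] tt.
by rewrite (nil_eq (cat_flatten_flatten [::] [::] [::])).
Qed.

Definition tight_category : category :=
  Category tight_comp_idl tight_comp_idr tight_comp_assoc.

End TightCategory.

Section LeftRepresentability.
Variable M : skew_multicategory.

(** The case [bs = [::]] says that [th] represents the functor of tight
    multimaps out of [a :: s] (resp. of loose multimaps out of [s]). *)
Definition tight_universal a s (m : mob M) (th : tight a s m) : Prop :=
  forall bs c, bijective (fun g : tight m bs c => tsub_head g th).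

Definition loose_universal s (m : mob M) (th : loose s m) : Prop :=
  forall bs c,
    bijective (fun g : tight m bs c => lsub_at (p := [::]) (forget g) th).

Definition left_representable : Prop :=
  (forall a s, exists (m : mob M) (th : tight a s m), tight_universal th) /\
  (forall s, exists (m : mob M) (th : loose s m), loose_universal th).

(** A skew monoidal structure on the category of tight unary maps is the one
    given by left representability: its tensor product and unit represent
    tight binary and loose nullary multimaps, and its structure maps are the
    induced ones. *)
Record tight_correspondence (A : skew_monoidal (tight_category M)) :=
    TightCorrespondence {
  tens_map : forall a b : mob M, tight a [:: b] (tens A a b);
  tens_map_universal : forall a b, tight_universal (tens_map a b);
  unit_map : loose [::] (unit_ob A : mob M);
  unit_map_universal : loose_universal unit_map;
  tensm_corr : forall (a a' b b' : mob M) (f : tight a [::] a')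
      (g : tight b [::] b'),
    tsub_head (tensm A f g : tight _ [::] _) (tens_map a b) =
    tsub (tens_map a' b') f (ass := [:: [:: b]]) (forget g, tt);
  assoc_corr : forall a b c : mob M,
    tsub_head (tsub_head (assoc A a b c : tight _ [::] _)
                 (tens_map (tens A a b) c))
      (tens_map a b) =
    tsub_at (p := [::]) (tens_map a (tens A b c)) (forget (tens_map b c));
  lunit_corr : forall a : mob M,
    lsub_at (p := [::]) (forget (lunit A a : tight _ [::] _))
      (lsub_at (p := [::]) (forget (tens_map (unit_ob A) a)) unit_map) =
    forget (tid a);
  runit_corr : forall a : mob M,
    (runit A a : tight _ [::] _) =
    tsub_at (p := [::]) (tens_map a (unit_ob A)) unit_map
}.

End LeftRepresentability.

Section SwapOperators.
Variables (O : Type) (X : seq O -> Type).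

(** [beta p x y q] is the operator exchanging the entries in places [j] and
    [j + 1] of the list, where [j = size p + 1]. *)
Definition swaps := forall p x y q, X (p ++ x :: y :: q) -> X (p ++ y :: x :: q).

Variable beta : swaps.

Definition swap_along s s' p x y q (e : s = p ++ x :: y :: q)
    (e' : s' = p ++ y :: x :: q) (g : X s) : X s' :=
  cast (X := X) (esym e') (beta (cast (X := X) e g)).

Definition swap_after p r x y q :
    X (p ++ r ++ x :: y :: q) -> X (p ++ r ++ y :: x :: q) :=
  swap_along (catA p r _) (catA p r _).

Definition swap_inner p r x y s q :
    X (p ++ (r ++ x :: y :: s) ++ q) -> X (p ++ (r ++ y :: x :: s) ++ q) :=
  swap_along (p := p ++ r) (q := s ++ q)
    (cat_inner p r (x :: y :: s) q) (cat_inner p r (y :: x :: s) q).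

Definition swap_outer p r q x y s :
    X (p ++ r ++ q ++ x :: y :: s) -> X (p ++ r ++ q ++ y :: x :: s) :=
  swap_along (cat_outer p r q _) (cat_outer p r q _).

(** With [j = size p + 1] and [n = size s], [move_left s p x q] is the word
    beta_(j+n-1) .. beta_j and [move_right s p x q] is beta_j .. beta_(j+n-1),
    where operators act on the right. *)
Fixpoint move_left s p x q : X (p ++ s ++ x :: q) -> X (p ++ x :: s ++ q) :=
  match s return X (p ++ s ++ x :: q) -> X (p ++ x :: s ++ q) with
  | [::] => fun g => g
  | a :: s' => fun g =>
      beta (cast (X := X) (esym (catA p [:: a] (x :: s' ++ q)))
        (move_left (cast (X := X) (catA p [:: a] (s' ++ x :: q)) g)))
  end.

Fixpoint move_right s p x q : X (p ++ x :: s ++ q) -> X (p ++ s ++ x :: q) :=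
  match s return X (p ++ x :: s ++ q) -> X (p ++ s ++ x :: q) with
  | [::] => fun g => g
  | a :: s' => fun g =>
      cast (X := X) (esym (catA p [:: a] (s' ++ x :: q)))
        (move_right (cast (X := X) (catA p [:: a] (x :: s' ++ q)) (beta g)))
  end.

Record braid_action : Prop := BraidAction {
  swap_bijective : forall p x y q, bijective (@beta p x y q);
  swap_far : forall p x y q z w r (g : X (p ++ x :: y :: q ++ z :: w :: r)),
    beta (q := q ++ w :: z :: r) (swap_after (r := x :: y :: q) g) =
    swap_after (r := y :: x :: q) (beta g);
  swap_braid : forall p x y z q (g : X (p ++ x :: y :: z :: q)),
    beta (swap_after (r := [:: y]) (beta g)) =
    swap_after (r := [:: z]) (beta (swap_after (r := [:: x]) g))
}.

End SwapOperators.

Section Equivariance.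
Variables (O : Type) (X : seq O -> Type) (Y : seq O -> O -> Type).
Variables (beta : swaps X) (betaY : forall b, swaps (Y^~ b)).
Variable sub : forall p b q s, X (p ++ b :: q) -> Y s b -> X (p ++ s ++ q).

Definition sub_after p r b q s (g : X (p ++ r ++ b :: q)) (f : Y s b) :
    X (p ++ r ++ s ++ q) :=
  cast (X := X) (esym (catA p r _)) (sub (cast (X := X) (catA p r _) g) f).

(** The last four conditions treat substitution in place [i] after beta_j
    for [j < i - 1], [j = i - 1], [j = i] and [j > i]. *)
Record equivariant : Prop := Equivariant {
  equiv_inner : forall p b q r x y s (g : X (p ++ b :: q))
      (f : Y (r ++ x :: y :: s) b),
    sub g (betaY f) = swap_inner beta (sub g f);
  equiv_before : forall p x y q b r s (g : X (p ++ x :: y :: q ++ b :: r))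
      (f : Y s b),
    sub_after (r := y :: x :: q) (beta g) f =
    beta (q := q ++ s ++ r) (sub_after (r := x :: y :: q) g f);
  equiv_left : forall p b x q s (g : X (p ++ b :: x :: q)) (f : Y s b),
    sub_after (r := [:: x]) (beta g) f = move_left beta (sub g f);
  equiv_right : forall p x b q s (g : X (p ++ x :: b :: q)) (f : Y s b),
    sub (beta g) f = move_right beta (sub_after (r := [:: x]) g f);
  equiv_beyond : forall p b q x y r s (g : X (p ++ b :: q ++ x :: y :: r))
      (f : Y s b),
    sub (q := q ++ y :: x :: r) (swap_after beta (r := b :: q) g) f =
    swap_outer beta (sub g f)
}.

End Equivariance.

Section Braiding.
Variable M : skew_multicategory.

(** In [tbeta] the list excludes the first source [a], which is never moved:
    the operator in place [j] of the list [p ++ x :: y :: q] is beta_(j+1). *)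
Record braiding := Braiding {
  lbeta : forall b : mob M, swaps (loose^~ b);
  tbeta : forall a b : mob M, swaps ((tight a)^~ b);
  lbeta_action : forall b, braid_action (@lbeta b);
  tbeta_action : forall a b, braid_action (@tbeta a b);
  forget_tbeta : forall a b p x y q (g : tight a (p ++ x :: y :: q) b),
    forget (tbeta g) = lbeta (p := a :: p) (forget g);
  lbeta_equivariant : forall c,
    equivariant (@lbeta c) lbeta (@lsub_at M c);
  tbeta_equivariant : forall a c,
    equivariant (@tbeta a c) lbeta (@tsub_at M a c);
  tbeta_head_inner : forall a b c q r x y s (g : tight b q c)
      (f : tight a (r ++ x :: y :: s) b),
    tsub_head g (tbeta f) =
    swap_inner (@tbeta a c) (p := [::]) (tsub_head g f);
  tbeta_head_beyond : forall a b c q x y r s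
      (g : tight b (q ++ x :: y :: r) c) (f : tight a s b),
    tsub_head (tbeta g) f = swap_after (@tbeta a c) (tsub_head g f)
}.

Definition is_symmetry (b : braiding) : Prop :=
  (forall c p x y q (g : loose (p ++ x :: y :: q) c),
     lbeta b (lbeta b g) = g) /\
  (forall a c p x y q (g : tight a (p ++ x :: y :: q) c),
     tbeta b (tbeta b g) = g).

Definition symmetry := {b : braiding | is_symmetry b}.

(** Precomposition with [s] corresponds to the action of beta_2 on tight
    ternary multimaps. *)
Definition induces (A : skew_monoidal (tight_category M))
    (E : tight_correspondence A) (beta : braiding) (s : swap_iso A) : Prop :=
  let restrict a b c d (h : tight (tens A (tens A a b) c) [::] d) :
      tight a [:: b; c] d :=
    tsub_head (tsub_head h (tens_map E (tens A a b) c)) (tens_map E a b) in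
  forall (a b c d : mob M) (h : tight (tens A (tens A a c) b) [::] d),
    restrict a b c d (tight_comp h (s a b c)) =
    tbeta beta (p := [::]) (restrict a c b d h).

End Braiding.

(* Main.v *)
Require Import Defs.
From mathcomp Require Import all_boot.
From Stdlib Require Import FunctionalExtensionality ProofIrrelevance.
From Stdlib Require Import IndefiniteDescription.

(** Write [e : a, b -> ab] for the universal tight map and [u] for the universal
    nullary one. Substitution of [e] in the first place ([expand]) identifies
    tight multimaps out of [ab, q] with those out of [a, b, q], and substitution
    of [u] ([loosen]) identifies tight multimaps out of [I, q] with loose ones
    out of [q]. A swap [σ] therefore yields operators on tight multimaps (absorb
    the leading sources, then precompose with [σ]) and hence on loose ones, and
    every braiding arises in this way from its [σ]. Under these identifications
    the braid relation is (B1). Substituting [f] at a later place of [expand g]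
    is precomposition of [g] with [slide f], which is built by induction on the
    sources of [f] from the associativity map; moving a source past [f] from the
    right or from the left is then (B2) or (B3) at each step of the induction,
    swapping inside [f] is (B4), and passing from tight to loose [f] needs the
    unit laws [s r = r 1] and [s (r 1) = r], which follow from (B2) and (B3). *)

Set Implicit Arguments.
Unset Strict Implicit.
Unset Printing Implicit Defensive.

Local Open Scope cat_scope.

(** * Substitution in one place *)

(** Source lists often agree only up to a propositional equality such as associativity of [++].
    Equality of dependent pairs ignores casts, and [heq_eq] returns to plain equality. *)
Definition heq (O : Type) (X : seq O -> Type) s s' (x : X s) (x' : X s') :=
  existT X s x = existT X s' x'.

Section HeterogeneousEquality.
Variables (O : Type) (X : seq O -> Type).

Lemma heq_eq s (x x' : X s) : heq x x' -> x = x'.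
Proof. exact: inj_pair2. Qed.

Lemma heq_cast s s' (e : s = s') (x : X s) : heq (cast e x) x.
Proof. by case: _ / e. Qed.

Lemma cast_id s (e : s = s) (x : X s) : cast e x = x.
Proof. exact/heq_eq/heq_cast. Qed.

Lemma heq_trans s1 s2 s3 (x1 : X s1) (x2 : X s2) (x3 : X s3) :
  heq x1 x2 -> heq x2 x3 -> heq x1 x3.
Proof. exact: etrans. Qed.

Lemma heq_sym s1 s2 (x1 : X s1) (x2 : X s2) : heq x1 x2 -> heq x2 x1.
Proof. exact: esym. Qed.

End HeterogeneousEquality.

(** * Families of multimaps encoded as plain lists *)

Section FamilyEncoding.
Variables (X Y : Type) (R : X -> Y -> Type).

(** Each multimap is packed with its own sources and target, so that families over different
    indexing lists can be compared as lists, without casts. *)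
Definition entry := {x : X & {y : Y & R x y}}.
Definition Entry x y (r : R x y) : entry := existT _ x (existT _ y r).

Fixpoint entries xs ys : fam R xs ys -> seq entry :=
  match xs, ys return fam R xs ys -> seq entry with
  | [::], [::] => fun=> [::]
  | _ :: _, _ :: _ => fun fs => Entry fs.1 :: entries fs.2
  | _, _ => fun fs => match fs with end
  end.

Lemma entries_cat xs ys xs' ys' (fs : fam R xs ys) (fs' : fam R xs' ys') :
  entries (fam_cat fs fs') = entries fs ++ entries fs'.
Proof. by elim: xs ys fs => [|x xs IH] [|y ys] //= fs; rewrite IH. Qed.

Fixpoint fam_of_entries (ts : seq entry) : {xs & {ys & fam R xs ys}} :=
  match ts with
  | [::] => existT _ [::] (existT _ [::] tt)
  | t :: ts' =>
    let: existT xs (existT ys fs) := fam_of_entries ts' in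
    let: existT x (existT y r) := t in
    existT _ (x :: xs) (existT _ (y :: ys) (r, fs))
  end.

Lemma entriesK xs ys (fs : fam R xs ys) :
  fam_of_entries (entries fs) = existT _ xs (existT _ ys fs).
Proof.
elim: xs ys fs => [|x xs IH] [|y ys] //=; first by case.
by case=> r fs; rewrite IH.
Qed.

Lemma entries_inj xs xs' ys (fs : fam R xs ys) (fs' : fam R xs' ys) :
  entries fs = entries fs' ->
  existT (fun xs => fam R xs ys) xs fs = existT _ xs' fs'.
Proof.
move=> /(congr1 fam_of_entries); rewrite !entriesK => e.
have /= e1 := f_equal (@projT1 _ _) e.
move: fs' e; case: xs' / e1 => fs' e.
by have -> : fs = fs' by apply: inj_pair2 (inj_pair2 _ _ _ _ _ e).
Qed.

End FamilyEncoding.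

Lemma entries_id (O : Type) (R : seq O -> O -> Type) (id : forall b, R [:: b] b)
    bs :
  entries (fam_id id bs) = [seq Entry (id b) | b <- bs].
Proof. by elim: bs => //= b bs ->. Qed.

Lemma Entry_heq (O : Type) (R : seq O -> O -> Type) s s' b (f : R s b)
    (f' : R s' b) :
  heq (X := R^~ b) f f' -> Entry f = Entry f'.
Proof.
move=> e; have /= e1 := f_equal (@projT1 _ _) e.
move: f' e; case: s' / e1 => f' e.
by rewrite (heq_eq e).
Qed.

(** * Associativity and identity laws up to equality of source lists *)

Section Multicategories.
Variable M : multicategory.
Implicit Types (b c : mob M) (s bs : seq (mob M)) (ass : seq (seq (mob M))).

Lemma lsub_heq bs bs' c (g : loose bs c) (g' : loose bs' c) ass ass'
    (fs : fam loose ass bs) (fs' : fam loose ass' bs') :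
  heq (X := loose^~ c) g g' -> entries fs = entries fs' ->
  heq (X := loose^~ c) (lsub g fs) (lsub g' fs').
Proof.
move=> e; have /= e1 := f_equal (@projT1 _ _) e.
move: g' fs' e; case: bs' / e1 => g' fs' e /entries_inj e'.
rewrite -(heq_eq e).
have /= e1 := f_equal (@projT1 _ _) e'.
move: fs' e'; case: ass' / e1 => fs' e'.
by rewrite (inj_pair2 _ _ _ _ _ e').
Qed.

Lemma lsub_idr_heq bs c (g : loose bs c) :
  heq (X := loose^~ c) (lsub g (fam_id lid bs)) g.
Proof. by rewrite /heq -[in RHS](lsub_idr g); apply/heq_sym/heq_cast. Qed.

Lemma lsub_idl_heq s b (f : loose s b) :
  heq (X := loose^~ b) (lsub (lid b) (ass := [:: s]) (f, tt)) f.
Proof. by rewrite /heq -[in RHS](lsub_idl f); apply/heq_sym/heq_cast. Qed.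

(** Only the entries of [ks] matter, so it need not be presented as a flattened double family. *)
Lemma lsub_assoc_heq bs c ass asss (g : loose bs c) (fs : fam loose ass bs)
    (hs : fam (fam loose) asss ass) ass' (ks : fam loose ass' (flatten ass)) :
  entries ks = entries (fam_flatten hs) ->
  heq (X := loose^~ c) (lsub (lsub g fs) ks) (lsub g (fam_sub (@lsub M) fs hs)).
Proof.
move=> e; rewrite -lsub_assoc; apply: heq_trans (heq_sym (heq_cast _ _)).
by apply: lsub_heq e.
Qed.

(** One of two degenerate double families to which associativity is applied: identities substituted
    into every member of a family. The other, [fam_singles], substitutes the members into
    identities. *)
Fixpoint fam_id_each ass :
    fam (fam loose) [seq [seq [:: a] | a <- s] | s <- ass] ass :=
  match ass with
  | [::] => tt
  | s :: ass' => (fam_id lid s, fam_id_each ass')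
  end.

Lemma entries_id_each ass :
  entries (fam_flatten (fam_id_each ass)) =
  [seq Entry (lid b) | b <- flatten ass].
Proof.
by elim: ass => //= s ass IH; rewrite entries_cat IH map_cat entries_id.
Qed.

Lemma sub_id_each ass bs (fs : fam loose ass bs) :
  entries (fam_sub (@lsub M) fs (fam_id_each ass)) = entries fs.
Proof.
elim: ass bs fs => [|s ass IH] [|b bs] //= fs.
by rewrite IH; congr cons; apply/Entry_heq/lsub_idr_heq.
Qed.

Fixpoint fam_singles ass bs : fam loose ass bs ->
    fam (fam loose) [seq [:: s] | s <- ass] [seq [:: b] | b <- bs] :=
  match ass, bs return fam loose ass bs ->
    fam (fam loose) [seq [:: s] | s <- ass] [seq [:: b] | b <- bs] with
  | [::], [::] => fun fs => fs
  | _ :: _, _ :: _ => fun fs => ((fs.1, tt), fam_singles fs.2)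
  | _, _ => fun fs => match fs with end
  end.

Lemma entries_singles ass bs (fs : fam loose ass bs) :
  entries (fam_flatten (fam_singles fs)) = entries fs.
Proof. by elim: ass bs fs => [|s ass IH] [|b bs] //= fs; rewrite IH. Qed.

Lemma id_sub_singles ass bs (fs : fam loose ass bs) :
  entries (fam_sub (@lsub M) (fam_id lid bs) (fam_singles fs)) = entries fs.
Proof.
elim: ass bs fs => [|s ass IH] [|b bs] //= fs.
by rewrite IH; congr cons; apply/Entry_heq/lsub_idl_heq.
Qed.

End Multicategories.

(** * Substitution into tight multimaps *)

Section TightSubstitution.
Variable M : skew_multicategory.
Implicit Types (a b c d : mob M) (p q s bs : seq (mob M)).
Implicit Types (ass : seq (seq (mob M))).

Lemma tsub_heq b bs bs' c (g : tight b bs c) (g' : tight b bs' c)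
    a s s' (f : tight a s b) (f' : tight a s' b) ass ass'
    (fs : fam loose ass bs) (fs' : fam loose ass' bs') :
  heq (X := (tight b)^~ c) g g' -> heq (X := (tight a)^~ b) f f' ->
  entries fs = entries fs' ->
  heq (X := (tight a)^~ c) (tsub g f fs) (tsub g' f' fs').
Proof.
move=> e; have /= e1 := f_equal (@projT1 _ _) e.
move: g' fs' e; case: bs' / e1 => g' fs' e; rewrite -(heq_eq e).
move=> {}e; have /= e1 := f_equal (@projT1 _ _) e.
move: f' e; case: s' / e1 => f' e; rewrite -(heq_eq e).
move=> /entries_inj {}e; have /= e1 := f_equal (@projT1 _ _) e.
by move: fs' e; case: ass' / e1 => fs' e; rewrite (inj_pair2 _ _ _ _ _ e).
Qed.

Lemma tsub_idr_heq b bs c (g : tight b bs c) :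
  heq (X := (tight b)^~ c) (tsub g (tid b) (fam_id lid bs)) g.
Proof. by rewrite /heq -[in RHS](tsub_idr g); apply/heq_sym/heq_cast. Qed.

Lemma tsub_idl_heq a s b (f : tight a s b) :
  heq (X := (tight a)^~ b) (tsub (tid b) f (ass := [::]) tt) f.
Proof. by rewrite /heq -[in RHS](tsub_idl f); apply/heq_sym/heq_cast. Qed.

Lemma tsub_assoc_heq c cs d (g : tight c cs d) b bs (f : tight b bs c)
    css (fs : fam loose css cs) a s (h : tight a s b) ass (hs : fam loose ass bs)
    asss (hss : fam (fam loose) asss css)
    ass' (ks : fam loose ass' (bs ++ flatten css)) :
  entries ks = entries hs ++ entries (fam_flatten hss) ->
  heq (X := (tight a)^~ d) (tsub (tsub g f fs) h ks)
    (tsub g (tsub f h hs) (fam_sub (@lsub M) fs hss)).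
Proof.
move=> e; rewrite -tsub_assoc; apply: heq_trans (heq_sym (heq_cast _ _)).
by apply: tsub_heq; rewrite ?entries_cat.
Qed.

Lemma tsub_head_heq c b q a s (g : tight b q c) (f : tight a s b) :
  heq (X := (tight a)^~ c) (tsub_head g f) (tsub g f (fam_id lid q)).
Proof. exact: heq_cast. Qed.

Definition sub_entries p q s b (f : loose s b) :=
  [seq Entry (lid x) | x <- p] ++ Entry f :: [seq Entry (lid x) | x <- q].

Lemma tsub_at_heq a c p b q s (g : tight a (p ++ b :: q) c) (f : loose s b)
    ass (fs : fam loose ass (p ++ b :: q)) :
  entries fs = sub_entries p q f ->
  heq (X := (tight a)^~ c) (tsub_at g f) (tsub g (tid a) fs).
Proof.
move=> e; apply: heq_trans (heq_cast _ _) _.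
by apply: (tsub_heq (s := [::]) (s' := [::])); rewrite ?entries_cat /= ?entries_id ?e.
Qed.

Lemma lsub_at_heq c p b q s (g : loose (p ++ b :: q) c) (f : loose s b)
    ass (fs : fam loose ass (p ++ b :: q)) :
  entries fs = sub_entries p q f ->
  heq (X := loose^~ c) (lsub_at g f) (lsub g fs).
Proof.
move=> e; apply: heq_trans (heq_cast _ _) _; apply: lsub_heq => //.
by rewrite entries_cat /= !entries_id e.
Qed.

(** The instance of associativity in which the members of [fs] receive only identities. *)
Lemma tsub_head_tsub c cs d (g : tight c cs d) b bs (f : tight b bs c)
    css (fs : fam loose css cs) a s (h : tight a s b) :
  heq (X := (tight a)^~ d) (tsub_head (tsub g f fs) h)
    (tsub g (tsub_head f h) fs).
Proof.
apply: heq_trans (tsub_head_heq _ _) _.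
apply: (heq_trans (tsub_assoc_heq (hs := fam_id lid bs)
                     (hss := fam_id_each css) _ _ _ _ _)).
  by rewrite entries_id_each !entries_id map_cat.
by apply: tsub_heq; rewrite ?sub_id_each //; apply/heq_sym/tsub_head_heq.
Qed.

(** The instance of associativity in which [g] first receives identities after [f], so that [ks]
    goes straight into [g]. *)
Lemma tsub_tsub_head c cs d (g : tight c cs d) b bs (f : tight b bs c)
    a s (h : tight a s b) ass (hs : fam loose ass bs)
    ass' (ks : fam loose ass' cs) ass'' (ls : fam loose ass'' (bs ++ cs)) :
  entries ls = entries hs ++ entries ks ->
  heq (X := (tight a)^~ d) (tsub (tsub_head g f) h ls)
    (tsub g (tsub f h hs) ks).
Proof.
move=> e.
apply: (@heq_trans _ _ _ _ _ _ (tsub (tsub g f (fam_id lid cs)) h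
  (fam_cat hs (fam_flatten (fam_singles ks))))).
  by apply: tsub_heq; rewrite ?entries_cat ?entries_singles //; apply: heq_cast.
apply: (heq_trans (tsub_assoc_heq (hs := hs) (hss := fam_singles ks) _ _ _ _ _)).
  by rewrite entries_cat.
by apply: tsub_heq; rewrite ?id_sub_singles.
Qed.

Lemma tsub_head_assoc c cs d (g : tight c cs d) b bs (f : tight b bs c)
    a s (h : tight a s b) :
  heq (X := (tight a)^~ d) (tsub_head (tsub_head g f) h)
    (tsub_head g (tsub_head f h)).
Proof.
apply: heq_trans (tsub_head_heq _ _) _.
apply: (@heq_trans _ _ _ _ _ _ (tsub g (tsub f h (fam_id lid bs)) (fam_id lid cs))).
  by apply: tsub_tsub_head; rewrite !entries_id map_cat.
apply: heq_trans (heq_sym (tsub_head_heq _ _)).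
by apply: tsub_heq => //; apply/heq_sym/tsub_head_heq.
Qed.

Lemma tsub_head_id c b q (g : tight b q c) : tsub_head g (tid b) = g.
Proof.
exact: (heq_eq (X := (tight b)^~ c)
  (heq_trans (tsub_head_heq _ _) (tsub_idr_heq _))).
Qed.

Lemma tsub_head_idl b a s (f : tight a s b) :
  heq (X := (tight a)^~ b) (tsub_head (tid b) f) f.
Proof. by apply: heq_trans (tsub_head_heq _ _) _; apply: tsub_idl_heq. Qed.

(** Both sides are the simultaneous substitution of [h] in the first place and [f] at its own place
    of [g]. The map [k] is [tsub_head g h] with its source list reassociated. *)
Lemma tsub_head_at d c p b q s a r (g : tight d (p ++ b :: q) c) (f : loose s b)
    (h : tight a r d) (k : tight a ((r ++ p) ++ b :: q) c) :
  heq (X := (tight a)^~ c) (tsub_head g h) k ->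
  heq (X := (tight a)^~ c) (tsub_head (tsub_at g f) h) (tsub_at k f).
Proof.
move=> e; set F := fam_cat (fam_id lid p)
  ((f, fam_id lid q) : fam _ (s :: [seq [:: x] | x <- q]) (b :: q)).
have eF : entries F = sub_entries p q f by rewrite entries_cat /= !entries_id.
apply: (@heq_trans _ _ _ _ _ _ (tsub_head (tsub g (tid d) F) h)).
  rewrite /tsub_head; apply: heq_trans (heq_cast _ _) _.
  apply: heq_trans (heq_sym (heq_cast _ _)).
  by apply: tsub_heq; rewrite ?entries_id ?flatten_insert //; exact: heq_cast.
apply: heq_trans (tsub_head_tsub _ _ _ _) _.
apply: (@heq_trans _ _ _ _ _ _ (tsub g (tsub h (tid a) (fam_id lid r)) F)).
  apply: tsub_heq => //; apply: heq_trans (tsub_head_idl _) _.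
  exact/heq_sym/tsub_idr_heq.
set G := fam_cat (fam_id lid (r ++ p))
  ((f, fam_id lid q) : fam _ (s :: [seq [:: x] | x <- q]) (b :: q)).
have eG : entries G = sub_entries (r ++ p) q f by rewrite entries_cat /= !entries_id.
apply: heq_trans (heq_sym (tsub_at_heq _ eG)).
apply: (heq_trans (heq_sym (tsub_tsub_head (ls := fam_cat (fam_id lid r) F) _ _ _ _))).
  by rewrite entries_cat.
apply: tsub_heq => //.
by rewrite eG entries_cat eF entries_id /sub_entries map_cat catA.
Qed.

(** [e] is an instance of [heq] because [s ++ [::]] does not reduce. *)
Lemma tsub_at_head c q d (g : tight c q d) a b (h : tight a [:: b] c)
    s (f : loose s b) (k : tight a s c) :
  heq (X := (tight a)^~ c) (tsub h (tid a) (ass := [:: s]) (f, tt)) k ->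
  tsub_at (p := [::]) (q := q) (tsub_head g h) f = tsub_head g k.
Proof.
move=> e; apply: (heq_eq (X := (tight a)^~ d)).
have eF : entries ((f, fam_id lid q) :
    fam _ (s :: [seq [:: x] | x <- q]) (b :: q)) = sub_entries [::] q f.
  by rewrite /= entries_id.
apply: (heq_trans (tsub_at_heq (p := [::]) (tsub_head g h) eF)).
apply: (heq_trans (tsub_tsub_head (hs := ((f, tt) : fam _ [:: s] [:: b]))
                     (ks := fam_id lid q) _ _ _ _)).
  by rewrite eF /= entries_id.
by apply: (heq_trans _ (heq_sym (tsub_head_heq g k))); apply: tsub_heq.
Qed.

Lemma tsub_at_binary a b c (h : tight a [:: b] c) s (f : loose s b) :
  heq (X := (tight a)^~ c) (tsub h (tid a) (ass := [:: s]) (f, tt))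
    (tsub_at (p := [::]) (q := [::]) h f).
Proof.
pose F := ((f, tt) : fam loose [:: s] [:: b]).
have eF : entries F = sub_entries [::] [::] f by [].
exact: heq_sym (tsub_at_heq (p := [::]) (q := [::]) h eF).
Qed.

Lemma tsub_at_assoc a c b q (g : tight a (b :: q) c) d s (f : tight d s b)
    r (h : loose r d) (k : loose (r ++ s) b) :
  heq (X := loose^~ b) (lsub_at (p := [::]) (q := s) (forget f) h) k ->
  heq (X := (tight a)^~ c) (tsub_at (p := [::]) (q := q) g k)
    (tsub_at (p := [::]) (q := s ++ q)
      (tsub_at (p := [::]) (q := q) g (forget f)) h).
Proof.
move=> e; pose F := ((forget f, fam_id lid q) : fam loose
  ((d :: s) :: [seq [:: x] | x <- q]) ([::] ++ b :: q)).
pose hs := ((h, fam_id lid s) : fam loose (r :: [seq [:: x] | x <- s]) (d :: s)).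
(* [h] and identities enter [f], while every further member of [F] is an identity receiving an
   identity. *)
pose H := ((hs, fam_singles (fam_id lid q)) : fam (fam loose)
  ((r :: [seq [:: x] | x <- s]) :: [seq [:: x] | x <- [seq [:: x] | x <- q]])
  ((d :: s) :: [seq [:: x] | x <- q])).
have eF : entries F = sub_entries [::] q (forget f) by rewrite /= entries_id.
pose G := ((h, fam_id lid (s ++ q)) : fam loose
  (r :: [seq [:: x] | x <- s ++ q]) ([::] ++ d :: s ++ q)).
have eG : entries G = sub_entries [::] (s ++ q) h by rewrite /= entries_id.
apply: heq_sym; apply: (heq_trans (tsub_at_heq (p := [::]) _ eG)).
apply: (@heq_trans _ _ _ _ _ _ (tsub (tsub g (tid a) F) (tid a) (fam_flatten H))).
  apply: tsub_heq => //; first exact: (tsub_at_heq (p := [::]) g eF).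
  by rewrite /= entries_cat entries_singles !entries_id map_cat.
apply: (heq_trans (tsub_assoc_heq (hs := (tt : fam loose [::] [::]))
                     (hss := H) _ _ _ _ _)) => //.
pose K := ((k, fam_id lid q) : fam loose (_ :: [seq [:: x] | x <- q])
  ([::] ++ b :: q)).
have eK : entries K = sub_entries [::] q k by rewrite /= entries_id.
apply: (heq_trans _ (heq_sym (tsub_at_heq (p := [::]) _ eK))).
apply: tsub_heq => //; first exact: tsub_idl_heq.
rewrite /= id_sub_singles; congr cons; apply: Entry_heq.
apply: (heq_trans _ e); apply: heq_sym.
have eh : entries hs = sub_entries [::] s h by rewrite /= entries_id.
exact: (lsub_at_heq (p := [::]) (forget f) eh).
Qed.

End TightSubstitution.

(** * Substitution into loose multimaps, and its relation to [forget] *)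

Section LooseSubstitution.
Variable M : skew_multicategory.
Implicit Types (a b c d : mob M) (p q s bs : seq (mob M)).

Lemma lsub_at_id a q c (g : loose (a :: q) c) :
  lsub_at (p := [::]) (q := q) g (lid a) = g.
Proof.
apply: (heq_eq (X := loose^~ c)).
have e : entries (fam_id lid (a :: q)) = sub_entries [::] q (lid a).
  by rewrite entries_id.
exact: heq_trans (lsub_at_heq (p := [::]) g e) (lsub_idr_heq g).
Qed.

Lemma lsub_at_assoc b q c (g : loose (b :: q) c) d s (f : loose (d :: s) b)
    r (h : loose r d) k :
  heq (X := loose^~ b) (lsub_at (p := [::]) (q := s) f h) k ->
  heq (X := loose^~ c)
    (lsub_at (p := [::]) (q := s ++ q) (lsub_at (p := [::]) (q := q) g f) h)
    (lsub_at (p := [::]) (q := q) g (k : loose (r ++ s) b)).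
Proof.
move=> e; pose F := ((f, fam_id lid q) : fam loose
  ((d :: s) :: [seq [:: x] | x <- q]) ([::] ++ b :: q)).
pose hs := ((h, fam_id lid s) : fam loose (r :: [seq [:: x] | x <- s]) (d :: s)).
pose H := ((hs, fam_singles (fam_id lid q)) : fam (fam loose)
  ((r :: [seq [:: x] | x <- s]) :: [seq [:: x] | x <- [seq [:: x] | x <- q]])
  ((d :: s) :: [seq [:: x] | x <- q])).
have eF : entries F = sub_entries [::] q f by rewrite /= entries_id.
pose G := ((h, fam_id lid (s ++ q)) : fam loose
  (r :: [seq [:: x] | x <- s ++ q]) ([::] ++ d :: s ++ q)).
have eG : entries G = sub_entries [::] (s ++ q) h by rewrite /= entries_id.
apply: (heq_trans (lsub_at_heq (p := [::]) _ eG)).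
apply: (@heq_trans _ _ _ _ _ _ (lsub (lsub g F) (fam_flatten H))).
  apply: lsub_heq; first exact: (lsub_at_heq (p := [::]) g eF).
  by rewrite /= entries_cat entries_singles !entries_id map_cat.
apply: (heq_trans (lsub_assoc_heq (hs := H) _ _ _)) => //.
pose K := ((k, fam_id lid q) : fam loose (_ :: [seq [:: x] | x <- q])
  ([::] ++ b :: q)).
have eK : entries K = sub_entries [::] q k by rewrite /= entries_id.
apply: (heq_trans _ (heq_sym (lsub_at_heq (p := [::]) g eK))).
apply: lsub_heq => //.
rewrite /= id_sub_singles; congr cons; apply: Entry_heq.
apply: (heq_trans _ e); apply: heq_sym.
have eh : entries hs = sub_entries [::] s h by rewrite /= entries_id.
exact: (lsub_at_heq (p := [::]) f eh).
Qed.

(** Both sides are the simultaneous substitution of [u] and [f] into [g]. *)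
Lemma lsub_at_comm i p b q c (g : loose (i :: p ++ b :: q) c)
    (u : loose [::] i) s (f : loose s b) :
  lsub_at (p := p) (q := q)
    (lsub_at (p := [::]) (q := p ++ b :: q) g u : loose (p ++ b :: q) c) f =
  lsub_at (p := [::]) (q := p ++ s ++ q) (lsub_at (p := i :: p) (q := q) g f) u.
Proof.
apply: (heq_eq (X := loose^~ c)).
pose F := fam_cat (fam_id lid p)
  ((f, fam_id lid q) : fam loose (s :: [seq [:: x] | x <- q]) (b :: q)).
have eF : entries F = sub_entries p q f by rewrite entries_cat /= !entries_id.
(* With first member [u] this gives the simultaneous substitution, and with the identity of [i] the
   substitution of [f] alone. *)
pose H r (k : loose r i) := ((k, F) : fam loose (r :: _) (i :: p ++ b :: q)).
apply: (@heq_trans _ _ _ _ _ _ (lsub g (H _ u))).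
  apply: (heq_trans (lsub_at_heq _ eF)).
  pose us := ((u, fam_id lid (p ++ b :: q)) : fam loose
    ([::] :: [seq [:: x] | x <- p ++ b :: q]) ([::] ++ i :: p ++ b :: q)).
  have eu : entries us = sub_entries [::] (p ++ b :: q) u.
    by rewrite /= entries_id.
  apply: (@heq_trans _ _ _ _ _ _
    (lsub (lsub g us) (fam_flatten (fam_singles F)))).
    apply: lsub_heq; first exact: (lsub_at_heq (p := [::]) g eu).
    by rewrite entries_singles.
  apply: (heq_trans (lsub_assoc_heq
    (hs := ((tt, fam_singles F) : fam (fam loose) ([::] :: _) ([::] :: _)))
    _ _ _)) => //.
  apply: lsub_heq => //; rewrite /= id_sub_singles; congr cons.
  exact/Entry_heq/(lsub_idr_heq u).
have ei : entries (H _ (lid i)) = sub_entries (i :: p) q f by rewrite /= eF.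
pose us := ((u, fam_id lid (p ++ s ++ q)) : fam loose
  ([::] :: [seq [:: x] | x <- p ++ s ++ q]) ([::] ++ i :: p ++ s ++ q)).
have eu : entries us = sub_entries [::] (p ++ s ++ q) u.
  by rewrite /= entries_id.
apply: heq_sym; apply: (heq_trans (lsub_at_heq (p := [::]) _ eu)).
pose K := (((u, tt) : fam loose [:: [::]] [:: i],
            fam_id_each ([seq [:: x] | x <- p] ++ s :: [seq [:: x] | x <- q]))
  : fam (fam loose) ([:: [::]] :: _) ([:: i] :: _)).
apply: (@heq_trans _ _ _ _ _ _ (lsub (lsub g (H _ (lid i))) (fam_flatten K))).
  apply: lsub_heq; first exact: (lsub_at_heq (p := i :: p) g ei).
  rewrite eu /= entries_id_each flatten_cat /= !flatten_seq1.
  by rewrite /sub_entries.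
apply: (heq_trans (lsub_assoc_heq (hs := K) _ _ _)) => //.
apply: lsub_heq => //; rewrite /= sub_id_each; congr cons.
exact/Entry_heq/(lsub_idl_heq u).
Qed.

Lemma forget_heq a c s s' (g : tight a s c) (g' : tight a s' c) :
  heq (X := (tight a)^~ c) g g' -> heq (X := loose^~ c) (forget g) (forget g').
Proof.
move=> e; have /= e1 := f_equal (@projT1 _ _) e.
by move: g' e; case: s' / e1 => g' e; rewrite (heq_eq e).
Qed.

Lemma forget_tsub_head b c q a s (g : tight b q c) (f : tight a s b) :
  forget (tsub_head g f) = lsub_at (p := [::]) (q := q) (forget g) (forget f).
Proof.
apply: (heq_eq (X := loose^~ c)).
apply: (heq_trans (forget_heq (tsub_head_heq g f))).
by rewrite forget_tsub; apply: heq_sym; apply: heq_cast.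
Qed.

Lemma forget_tsub_at a c p b q s (g : tight a (p ++ b :: q) c) (f : loose s b) :
  forget (tsub_at g f) = lsub_at (p := a :: p) (forget g) f.
Proof.
apply: (heq_eq (X := loose^~ c)).
apply: (heq_trans (forget_heq (heq_cast (X := (tight a)^~ c) _ _))).
apply: (heq_trans (f_equal (existT (loose^~ c) _) (forget_tsub g (tid a) _))).
by rewrite forget_tid; apply: heq_sym; apply: heq_cast.
Qed.

End LooseSubstitution.

Section Inverse.
Variables (S T : Type) (f : S -> T) (bij_f : bijective f).

(** Representability asserts bijectivity as a proposition, so choice extracts an inverse that
    definitions can use. *)
Definition inverse : T -> S :=
  sval (constructive_indefinite_description (fun g => cancel f g /\ cancel g f)
    (let: Bijective g fK gK := bij_f in ex_intro _ g (conj fK gK))).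

Lemma inverseK : cancel f inverse.
Proof. by rewrite /inverse; case: constructive_indefinite_description => g []. Qed.

Lemma inverseKV : cancel inverse f.
Proof. by rewrite /inverse; case: constructive_indefinite_description => g []. Qed.

End Inverse.

(** * Absorbing sources into a tensor product *)

Section Expansion.
Variables (M : skew_multicategory) (A : skew_monoidal (tight_category M)).
Variable E : tight_correspondence A.
Implicit Types (a b c d x y z : mob M) (p q r s : seq (mob M)).

Local Notation "a ⊗ b" := (tens A a b) (at level 38, left associativity).
Local Notation "f ⊠ g" := (tensm A f g) (at level 38, left associativity).
Local Notation I := (unit_ob A : mob M).

(** [tsub_head] along a unary tight multimap, typed without [[::] ++ q]. *)
Definition pre a b q c (g : tight b q c) (f : tight a [::] b) : tight a q c :=
  tsub_head g f.
Local Notation "g ⋆ f" := (pre g f) (at level 40, left associativity).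

Lemma preE a b c (g : tight b [::] c) (f : tight a [::] b) :
  g ⋆ f = tight_comp g f.
Proof. exact: cast_id. Qed.

Lemma pre_id b q c (g : tight b q c) : g ⋆ tid b = g.
Proof. exact: tsub_head_id. Qed.

Lemma head_pre a b b' q s c (g : tight b q c) (f : tight b' s b)
    (h : tight a [::] b') :
  tsub_head g (f ⋆ h) = (tsub_head g f : tight b' (s ++ q) c) ⋆ h.
Proof. exact: esym (heq_eq (X := (tight a)^~ c) (tsub_head_assoc g f h)). Qed.

Lemma pre_pre a b c q d (g : tight c q d) (f : tight b [::] c)
    (h : tight a [::] b) :
  g ⋆ f ⋆ h = g ⋆ tight_comp f h.
Proof. by rewrite -preE; exact: esym (head_pre (s := [::]) g f h). Qed.

Lemma at_pre a a' p b q c s (g : tight a' (p ++ b :: q) c) (h : tight a [::] a')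
    (f : loose s b) :
  tsub_at (g ⋆ h) f = tsub_at g f ⋆ h.
Proof.
exact: esym (heq_eq (X := (tight a)^~ c)
  (tsub_head_at (r := [::]) (k := g ⋆ h) f (erefl _))).
Qed.

Definition expand a b q c (g : tight (a ⊗ b) q c) : tight a (b :: q) c :=
  tsub_head g (tens_map E a b).

Definition bundle a b q c : tight a (b :: q) c -> tight (a ⊗ b) q c :=
  inverse (tens_map_universal E a b q c).

Lemma expandK a b q c : cancel (@expand a b q c) (@bundle a b q c).
Proof. exact: inverseK. Qed.

Lemma bundleK a b q c : cancel (@bundle a b q c) (@expand a b q c).
Proof. exact: inverseKV. Qed.

Lemma expand_inj a b q c : injective (@expand a b q c).
Proof. exact: can_inj (@expandK a b q c). Qed.

Definition loosen q c (g : tight I q c) : loose q c :=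
  lsub_at (p := [::]) (forget g) (unit_map E).

Definition tighten q c : loose q c -> tight I q c :=
  inverse (unit_map_universal E q c).

Lemma loosenK q c : cancel (@loosen q c) (@tighten q c).
Proof. exact: inverseK. Qed.

Lemma tightenK q c : cancel (@tighten q c) (@loosen q c).
Proof. exact: inverseKV. Qed.

Lemma head_expand a x b s q c (g : tight b q c) (f : tight (a ⊗ x) s b) :
  tsub_head g (expand f) = expand (tsub_head g f : tight (a ⊗ x) (s ++ q) c).
Proof.
exact: esym (heq_eq (X := (tight a)^~ c)
  (tsub_head_assoc g f (tens_map E a x))).
Qed.

(** Naturality of the universal map [a, b -> ab] in [a], from [tensm_corr] with an identity as
    second factor. *)
Lemma expand_pre a a' b q c (g : tight (a' ⊗ b) q c) (h : tight a [::] a') :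
  expand g ⋆ h = expand (g ⋆ (h ⊠ tid b)).
Proof.
rewrite -[RHS](head_expand (s := [::]) g (h ⊠ tid b)).
rewrite -[LHS](head_pre (s := [:: b])); congr (@tsub_head M c _ q a [:: b] g _).
rewrite /expand tensm_corr forget_tid /pre.
exact: (heq_eq (X := (tight a)^~ (a' ⊗ b)) (tsub_head_heq (q := [:: b]) _ h)).
Qed.

Lemma at_expand a z p b q c s (g : tight (a ⊗ z) (p ++ b :: q) c)
    (f : loose s b) :
  tsub_at (p := z :: p) (q := q) (expand g) f = expand (tsub_at g f).
Proof.
exact: esym (heq_eq (X := (tight a)^~ c)
  (tsub_head_at (r := [:: z]) (k := expand g) f (erefl _))).
Qed.

Lemma at_expand_unary a b d q c (g : tight (a ⊗ b) q c) (f : tight d [::] b) :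
  tsub_at (p := [::]) (q := q) (expand g) (forget f) =
  expand (g ⋆ (tid a ⊠ f)).
Proof.
rewrite -[RHS](head_expand (s := [::])).
apply: tsub_at_head.
by rewrite /expand tensm_corr.
Qed.

(** [assoc_corr], the defining equation of the associativity map, composed with [g]. *)
Lemma at_expand_tens a b d q c (g : tight (a ⊗ (b ⊗ d)) q c) :
  tsub_at (p := [::]) (q := q) (expand g) (forget (tens_map E b d)) =
  expand (expand (g ⋆ assoc A a b d)).
Proof.
have <- : tsub_head g (expand (expand (assoc A a b d : tight _ [::] _))) =
    expand (expand (g ⋆ assoc A a b d)).
  rewrite (head_expand (s := [:: d])); congr expand.
  exact: (head_expand (s := [::])).
by apply: tsub_at_head; rewrite /expand assoc_corr; apply: tsub_at_binary.
Qed.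

Lemma at_expand_unit a q c (g : tight (a ⊗ I) q c) :
  tsub_at (p := [::]) (q := q) (expand g) (unit_map E) = g ⋆ runit A a.
Proof.
by apply: tsub_at_head; rewrite (runit_corr E); apply: tsub_at_binary.
Qed.

Lemma loosen_at p b q s c (g : tight I (p ++ b :: q) c) (f : loose s b) :
  loosen (tsub_at g f) = lsub_at (loosen g) f.
Proof. by rewrite /loosen lsub_at_comm -forget_tsub_at. Qed.

(** This is the expansion of the left unit map, since by [lunit_corr] both loosen to the loose
    identity. *)
Definition unitor a : tight I [:: a] a := tighten (lid a).

Lemma loosen_unitor a q c (g : tight a q c) :
  loosen (tsub_head g (unitor a) : tight I (a :: q) c) = forget g.
Proof.
rewrite -[RHS]lsub_at_id -[in RHS](tightenK (lid a)) /loosen.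
rewrite [forget (_ : tight _ (_ :: _) _)](forget_tsub_head g (unitor a)).
exact: (heq_eq (X := loose^~ c)
  (lsub_at_assoc (s := [:: a]) (r := [::]) (forget g) (erefl _))).
Qed.

Lemma at_loosen a b q c (g : tight a (b :: q) c) s (f : tight I s b) :
  tsub_at (p := [::]) (q := q) g (loosen f) =
  tsub_at (p := [::]) (q := s ++ q)
    (tsub_at (p := [::]) (q := q) g (forget f)) (unit_map E).
Proof.
exact: (heq_eq (X := (tight a)^~ c) 
  (@tsub_at_assoc M a c b q g I s f [::] (unit_map E) (loosen f) (erefl _))).
Qed.

Lemma at_forget_expand a b q c (g : tight a (b :: q) c) d z s
    (f : tight (d ⊗ z) s b) :
  tsub_at (p := [::]) (q := q) g (forget (expand f)) =
  tsub_at (p := [::]) (q := s ++ q)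
    (tsub_at (p := [::]) (q := q) g (forget f)) (forget (tens_map E d z)).
Proof.
apply: (heq_eq (X := (tight a)^~ c)
  (@tsub_at_assoc M a c b q g (d ⊗ z) s f [:: d; z] (forget (tens_map E d z))
    (forget (expand f)) _)).
by rewrite /expand (forget_tsub_head f (tens_map E d z)).
Qed.

End Expansion.

(** * Transport of swaps, and of words in them, along a map of multimaps *)

Section SwapTransport.
Variables (O : Type) (X : seq O -> Type) (beta : swaps X).

Lemma heq_swap_along s s' p x y q (e : s = p ++ x :: y :: q)
    (e' : s' = p ++ y :: x :: q) (g : X s) (g' : X (p ++ x :: y :: q)) :
  heq g g' -> heq (swap_along beta e e' g) (beta g').
Proof.
move=> eg; apply: heq_trans (heq_cast _ _) _.
by rewrite (heq_eq (heq_trans (heq_cast e g) eg)).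
Qed.

Lemma swap_along_id p x y q (e : p ++ x :: y :: q = p ++ x :: y :: q)
    (e' : p ++ y :: x :: q = p ++ y :: x :: q) (g : X (p ++ x :: y :: q)) :
  swap_along beta e e' g = beta g.
Proof. by apply: heq_eq; apply: heq_swap_along. Qed.

Variables (X' : seq O -> Type) (beta' : swaps X') (l : seq O).
Variable phi : forall s, X s -> X' (l ++ s).

Lemma heq_phi s s' (g : X s) (g' : X s') : heq g g' -> heq (phi g) (phi g').
Proof.
move=> e; have /= e1 := f_equal (@projT1 _ _) e.
by move: g' e; case: s' / e1 => g' e; rewrite (heq_eq e).
Qed.

Hypothesis phi_beta : forall p x y q (g : X (p ++ x :: y :: q))
    (g' : X' ((l ++ p) ++ x :: y :: q)),
  heq (phi g) g' -> heq (phi (beta g)) (beta' g').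

(** Used with [phi] an expansion, where [l] is [[:: z]], and with [phi] a precomposition or a
    loosening, where [l] is empty. *)
Lemma phi_swap_along s1 s2 t1 t2 p x y q (e1 : s1 = p ++ x :: y :: q)
    (e2 : s2 = p ++ y :: x :: q) (e1' : t1 = (l ++ p) ++ x :: y :: q)
    (e2' : t2 = (l ++ p) ++ y :: x :: q) (g : X s1) (g' : X' t1) :
  heq (phi g) g' ->
  heq (phi (swap_along beta e1 e2 g)) (swap_along beta' e1' e2' g').
Proof.
move=> eg.
have h : heq (phi (cast e1 g)) (cast e1' g').
  apply: heq_trans (heq_phi (heq_cast _ _)) _; apply: heq_trans eg _.
  exact: heq_sym (heq_cast _ _).
apply: (heq_trans (heq_phi (heq_cast _ _))); apply: heq_trans (phi_beta h) _.
exact: heq_sym (heq_cast _ _).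
Qed.

(** The induction moves a source from [s] into the prefix, after which the prefixes match only up to
    associativity of [++]; hence the separate [p']. *)
Lemma phi_move_left s p p' x q (g : X (p ++ s ++ x :: q))
    (g' : X' (p' ++ s ++ x :: q)) :
  p' = l ++ p -> heq (phi g) g' ->
  heq (phi (move_left beta g)) (move_left beta' g').
Proof.
elim: s p p' g g' => //= a s IH p p' g g' ep eg; rewrite ep in g' eg *.
apply: phi_beta; apply: (heq_trans (heq_phi (heq_cast _ _))).
apply: (heq_trans _ (heq_sym (heq_cast _ _))); apply: IH; first by rewrite catA.
apply: (heq_trans (heq_phi (heq_cast _ _))); apply: heq_trans eg _.
exact: heq_sym (heq_cast _ _).
Qed.

Lemma phi_move_right s p p' x q (g : X (p ++ x :: s ++ q))
    (g' : X' (p' ++ x :: s ++ q)) :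
  p' = l ++ p -> heq (phi g) g' ->
  heq (phi (move_right beta g)) (move_right beta' g').
Proof.
elim: s p p' g g' => //= a s IH p p' g g' ep eg; rewrite ep in g' eg *.
apply: (heq_trans (heq_phi (heq_cast _ _))).
apply: (heq_trans _ (heq_sym (heq_cast _ _))); apply: IH; first by rewrite catA.
apply: (heq_trans (heq_phi (heq_cast _ _))).
apply: (heq_trans _ (heq_sym (heq_cast _ _))); exact: phi_beta.
Qed.

End SwapTransport.

(** * From a braiding on the category to operators on multimaps *)

Section UnitLaws.
Variables (C : category) (A : skew_monoidal C) (s : skew_braiding A).
Local Notation "a ⊗ b" := (tens A a b) (at level 38, left associativity).
Local Notation "f ⊠ g" := (tensm A f g) (at level 38, left associativity).
Local Notation I := (unit_ob A).
Local Notation α := (assoc A).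
Local Notation ρ := (runit A).
Local Notation λ := (lunit A).

Lemma iso_epi (a b c : C) (h : hom a b) (f g : hom b c) :
  is_iso h -> f ∘ h = g ∘ h -> f = g.
Proof.
case=> k [_ hk] e.
by rewrite -[f]comp_idr -[g]comp_idr -hk -!comp_assoc e.
Qed.

Lemma tensm_compl a b c d (f : hom b c) (g : hom a b) :
  (f ∘ g) ⊠ idc d = (f ⊠ idc d) ∘ (g ⊠ idc d).
Proof. by rewrite -tensm_comp comp_idl. Qed.

Lemma tensm_compr a b c d (f : hom b c) (g : hom a b) :
  idc d ⊠ (f ∘ g) = (idc d ⊠ f) ∘ (idc d ⊠ g).
Proof. by rewrite -tensm_comp comp_idl. Qed.

(** From (B2) at two copies of the unit object; invertibility of [s] allows cancelling it in
    [e1]. *)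
Lemma braiding_runit x a : s x a I ∘ ρ (x ⊗ a) = ρ x ⊠ idc a.
Proof.
set t := _ ∘ _.
have e1 : (α x I I ⊠ idc a) ∘ (s (x ⊗ I) a I ∘ ρ (x ⊗ I ⊗ a)) =
    idc x ⊠ ρ I ⊠ idc a.
  apply: (iso_epi (swap_invertible s x a I)).
  rewrite (swap_nat s (idc x) (idc a) (ρ I)) tensm_id -assoc_runit -[RHS]comp_assoc.
  by rewrite skew_B2 !comp_assoc runit_nat.
have e2 : s (x ⊗ I) a I ∘ ρ (x ⊗ I ⊗ a) ∘ (ρ x ⊠ idc a) =
    (ρ x ⊠ idc I ⊠ idc a) ∘ t.
  by rewrite comp_assoc -runit_nat -!comp_assoc (swap_nat s (ρ x) (idc a) (idc I)).
(* These two factors reduce the left side to [t] by [mid_unit], and the right side to [ρ x ⊠ idc a]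
   by [lunit_runit]. *)
have := congr1 (fun h => (idc x ⊠ λ I ⊠ idc a) ∘ (h ∘ (ρ x ⊠ idc a))) e1.
rewrite comp_assoc e2 -!comp_assoc -!tensm_compl mid_unit tensm_id comp_idl.
rewrite -/t => ->.
by rewrite -tensm_compr lunit_runit tensm_id comp_idl.
Qed.

(** From (B3) at two copies of the unit object, again cancelling an invertible [s]. *)
Lemma braiding_runit_mid x c : s x I c ∘ (ρ x ⊠ idc c) = ρ (x ⊗ c).
Proof.
set t := _ ∘ _.
have e1 : (idc (x ⊗ c) ⊠ λ I) ∘ α (x ⊗ c) I I ∘ (t ⊠ idc I) =
    idc (x ⊗ c ⊗ I).
  apply: (iso_epi (swap_invertible s x I c)); rewrite comp_idl tensm_compl.
  have /= := skew_B3 s x I I c.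
  move=> /(congr1 (fun h => (idc (x ⊗ c) ⊠ λ I) ∘ (h ∘ (ρ x ⊠ idc I ⊠ idc c)))).
  rewrite !comp_assoc -(swap_nat s (ρ x) (idc I) (idc c)) => <-.
  rewrite -tensm_compl -comp_assoc -tensm_id.
  rewrite (swap_nat s (idc x) (λ I) (idc c)) comp_assoc -tensm_compl.
  by rewrite -comp_assoc mid_unit tensm_id comp_idr.
(* The identity of [I] is inserted as [λ I ∘ ρ I], so that naturality of [ρ] brings [t] into the
   position required by [e1]. *)
rewrite -[LHS]comp_idl -tensm_id -lunit_runit tensm_compr.
rewrite -assoc_runit -!comp_assoc.
by rewrite comp_assoc -/t comp_assoc -runit_nat -comp_assoc e1 comp_idl.
Qed.

End UnitLaws.

(** * Substitution in the second place of an expansion *)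

Section Slide.
Variables (M : skew_multicategory) (A : skew_monoidal (tight_category M)).
Variable E : tight_correspondence A.
Implicit Types (a b c d x y z : mob M) (p q r s : seq (mob M)).

Local Notation "a ⊗ b" := (tens A a b) (at level 38, left associativity).
Local Notation "f ⊠ g" := (tensm A f g) (at level 38, left associativity).
Local Notation "g ⋆ f" := (pre g f) (at level 40, left associativity).
Local Notation I := (unit_ob A : mob M).
Local Notation α := (assoc A).

(** [expand (slide a f)] is the substitution of [forget f] in the second place
    of the universal map [a, b -> ab]; see [at_expand_forget]. *)
Fixpoint slide a s b : forall d, tight d s b -> tight (a ⊗ d) s (a ⊗ b) :=
  match s with
  | [::] => fun d f => tid a ⊠ f
  | z :: s' => fun d f => expand E (slide a (bundle E f) ⋆ α a d z)
  end.

Lemma slide_expand a d z s b (f : tight (d ⊗ z) s b) :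
  slide a (expand E f) = expand E (slide a f ⋆ α a d z).
Proof. by rewrite /= expandK. Qed.

Lemma slide_pre a d d' s b (f : tight d' s b) (h : tight d [::] d') :
  slide a (f ⋆ h) = slide a f ⋆ (tid a ⊠ h).
Proof.
elim: s d d' f h => [|z s IH] d d' f h.
  rewrite /= !preE -[RHS](tensm_comp A (tid a) (tid a) f h).
  by congr (_ ⊠ _); exact: esym (tight_comp_idl _).
rewrite -(bundleK E f) expand_pre !slide_expand IH expand_pre !pre_pre.
congr (expand _ (_ ⋆ _)).
exact: (assoc_nat A (tid a) h (tid z)).
Qed.

(** By induction on the sources of [f]: the unary case is naturality of the universal map, and each
    further source contributes one associativity map. *)
Lemma at_expand_forget a b d s q c (g : tight (a ⊗ b) q c) (f : tight d s b) :
  tsub_at (p := [::]) (q := q) (expand E g) (forget f) =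
  expand E (tsub_head g (slide a f) : tight (a ⊗ d) (s ++ q) c).
Proof.
elim: s d f => [|z s IH] d f; first exact: at_expand_unary.
rewrite -(bundleK E f) (at_forget_expand E) IH at_expand_tens slide_expand.
rewrite (head_expand E (s := s)); congr (expand _ (expand _ _)).
exact: esym (head_pre g (slide a (bundle E f)) _).
Qed.

(** Substituting the universal nullary map after [forget f] accounts for the factor [runit A a]. *)
Lemma at_expand_loosen a b s q c (g : tight (a ⊗ b) q c) (f : tight I s b) :
  tsub_at (p := [::]) (q := q) (expand E g) (loosen E f) =
  (tsub_head g (slide a f) : tight (a ⊗ I) (s ++ q) c) ⋆ runit A a.
Proof.
rewrite at_loosen at_expand_forget; exact: at_expand_unit.
Qed.

End Slide.

(** * Operators on tight multimaps generated by a swap *)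

Section TightSwaps.
Variables (M : skew_multicategory) (A : skew_monoidal (tight_category M)).
Variable E : tight_correspondence A.
Implicit Types (a b c d x y z : mob M) (p q r s : seq (mob M)).

Local Notation "a ⊗ b" := (tens A a b) (at level 38, left associativity).
Local Notation "f ⊠ g" := (tensm A f g) (at level 38, left associativity).
Local Notation "g ⋆ f" := (pre g f) (at level 40, left associativity).
Local Notation I := (unit_ob A : mob M).
Local Notation α := (assoc A).

Definition swap_family := forall x a b, tight (x ⊗ a ⊗ b) [::] (x ⊗ b ⊗ a).

(** [beta_head] is the correspondence of the theorem, with further sources [q];
    [beta_cons] says that the first two sources may be absorbed into one. *)
Record generated (σ : swap_family) (beta : forall a b, swaps ((tight a)^~ b)) :
    Prop := Generated {
  beta_head : forall a x y q c (g : tight (a ⊗ x ⊗ y) q c),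
    beta a c [::] x y q (expand E (expand E g)) =
    expand E (expand E (g ⋆ σ a y x));
  beta_cons : forall a z p x y q c (g : tight (a ⊗ z) (p ++ x :: y :: q) c),
    beta a c (z :: p) x y q (expand E g) = expand E (beta _ _ _ _ _ _ g)
}.

Fixpoint swaps_of (σ : swap_family) p : forall a c x y q,
    tight a (p ++ x :: y :: q) c -> tight a (p ++ y :: x :: q) c :=
  match p with
  | [::] => fun a c x y q g =>
      expand E (expand E (bundle E (bundle E g) ⋆ σ a y x))
  | z :: p' => fun a c x y q g => expand E (swaps_of σ (bundle E g))
  end.

Lemma swaps_of_generated σ : generated σ (fun a c p => @swaps_of σ p a c).
Proof. by split=> *; rewrite /= !expandK. Qed.

(** Every multimap on which an operator acts is an iterated expansion, so the two clauses of
    [generated] determine the operators. *)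
Lemma generated_unique σ beta beta' :
  generated σ beta -> generated σ beta' ->
  forall a c p x y q (g : tight a (p ++ x :: y :: q) c),
  beta a c p x y q g = beta' a c p x y q g.
Proof.
move=> hb hb' a c p; elim: p a => [|z p IH] a x y q g.
  by rewrite -(bundleK E g) -(bundleK E (bundle E g)) (beta_head hb)
    (beta_head hb').
by rewrite -(bundleK E g) (beta_cons hb) (beta_cons hb') IH.
Qed.

Section Generated.
Variables (σ : swap_family) (beta : forall a b, swaps ((tight a)^~ b)).
Hypothesis gen : generated σ beta.
Hypothesis σ_nat : forall x x' a a' b b' (f : tight x [::] x')
    (g : tight a [::] a') (h : tight b [::] b'),
  tight_comp (f ⊠ h ⊠ g) (σ x a b) = tight_comp (σ x' a' b') (f ⊠ g ⊠ h).

Lemma expand_beta_heq a z c p x y q (g : tight (a ⊗ z) (p ++ x :: y :: q) c)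
    (g' : tight a (([:: z] ++ p) ++ x :: y :: q) c) :
  heq (X := (tight a)^~ c) (expand E g : tight a ([:: z] ++ _) c) g' ->
  heq (X := (tight a)^~ c) (expand E (beta g) : tight a ([:: z] ++ _) c)
    (beta g').
Proof.
move=> e; have {}e : expand E g = g' by exact: (heq_eq (X := (tight a)^~ c)).
by rewrite -[g']e -(beta_cons gen).
Qed.

(** Naturality of [σ] in its first variable, carried to all positions by [beta_cons]. *)
Lemma beta_pre a d p x y q c (g : tight a (p ++ x :: y :: q) c)
    (h : tight d [::] a) :
  beta g ⋆ h = beta (g ⋆ h).
Proof.
elim: p a d g h => [|z p IH] a d g h.
  rewrite -(bundleK E g) -(bundleK E (bundle E g)) (beta_head gen).
  rewrite !expand_pre (beta_head gen) !pre_pre.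
  by rewrite (σ_nat h (tid y) (tid x)).
by rewrite -(bundleK E g) (beta_cons gen) !expand_pre (beta_cons gen) IH.
Qed.


Lemma expand_swap_along a z c s1 s2 p x y q (e1 : s1 = p ++ x :: y :: q)
    (e2 : s2 = p ++ y :: x :: q) (e1' : z :: s1 = z :: p ++ x :: y :: q)
    (e2' : z :: s2 = z :: p ++ y :: x :: q) (g : tight (a ⊗ z) s1 c) :
  swap_along (@beta a c) (p := z :: p) e1' e2' (expand E g) =
  expand E (swap_along (@beta _ c) e1 e2 g).
Proof.
apply/esym/(heq_eq (X := (tight a)^~ c)).
exact: (phi_swap_along (l := [:: z]) (phi := fun s => @expand _ _ E a z s c)
  (@expand_beta_heq a z c)).
Qed.

(** A unary [f] is handled by [beta_pre]; each further source of [f] is absorbed and only lengthens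
    the prefix. *)
Lemma beta_tsub_head a b c q x y r s (g : tight b (q ++ x :: y :: r) c)
    (f : tight a s b) :
  tsub_head (beta g) f = swap_after (@beta a c) (tsub_head g f).
Proof.
elim: s a f => [|z s IH] a f.
  rewrite /swap_after swap_along_id; exact: (beta_pre g f).
rewrite -(bundleK E f) !head_expand IH; apply: esym.
exact: expand_swap_along.
Qed.

Lemma tsub_head_beta a b c q r x y s (g : tight b q c)
    (f : tight a (r ++ x :: y :: s) b) :
  tsub_head g (beta f) = swap_inner (@beta a c) (p := [::]) (tsub_head g f).
Proof.
elim: r a f => [|z r IH] a f.
  rewrite /swap_inner (swap_along_id _ (p := [::]) (q := s ++ q)).
  rewrite -(bundleK E f) -(bundleK E (bundle E f)) (beta_head gen).
  rewrite !(head_expand E (s := _ :: _)) !head_expand (beta_head gen).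
  by congr (expand _ (expand _ _)); exact: head_pre.
rewrite -(bundleK E f) (beta_cons gen) !head_expand IH; apply: esym.
exact: expand_swap_along.
Qed.

Lemma expand_move_left a z c s p x q (g : tight (a ⊗ z) (p ++ s ++ x :: q) c) :
  move_left (@beta a c) (p := z :: p) (expand E g) =
  expand E (move_left (@beta _ c) g).
Proof.
apply/esym/(heq_eq (X := (tight a)^~ c)).
exact: (phi_move_left (l := [:: z]) (phi := fun s => @expand _ _ E a z s c)
  (@expand_beta_heq a z c)).
Qed.

Lemma expand_move_right a z c s p x q (g : tight (a ⊗ z) (p ++ x :: s ++ q) c) :
  move_right (@beta a c) (p := z :: p) (expand E g) =
  expand E (move_right (@beta _ c) g).
Proof.
apply/esym/(heq_eq (X := (tight a)^~ c)).
exact: (phi_move_right (l := [:: z]) (phi := fun s => @expand _ _ E a z s c)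
  (@expand_beta_heq a z c)).
Qed.

Lemma pre_beta_heq a a' (h : tight a [::] a') c p x y q
    (g : tight a' (p ++ x :: y :: q) c)
    (g' : tight a (([::] ++ p) ++ x :: y :: q) c) :
  heq (X := (tight a)^~ c) (g ⋆ h : tight a ([::] ++ _) c) g' ->
  heq (X := (tight a)^~ c) (beta g ⋆ h : tight a ([::] ++ _) c) (beta g').
Proof.
move=> e; have {}e : g ⋆ h = g' by exact: (heq_eq (X := (tight a)^~ c)).
by rewrite -[g']e beta_pre.
Qed.

Lemma swap_along_pre a a' (h : tight a [::] a') c s1 s2 p x y q
    (e1 e1' : s1 = p ++ x :: y :: q) (e2 e2' : s2 = p ++ y :: x :: q)
    (g : tight a' s1 c) :
  swap_along (@beta a' c) e1 e2 g ⋆ h = swap_along (@beta a c) e1' e2' (g ⋆ h).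
Proof.
apply/(heq_eq (X := (tight a)^~ c)).
exact: (phi_swap_along (l := [::]) (phi := fun s g => @pre _ a a' s c g h)
  (@pre_beta_heq a a' h c)).
Qed.

Lemma move_left_pre a a' (h : tight a [::] a') c s p x q
    (g : tight a' (p ++ s ++ x :: q) c) :
  move_left (@beta a' c) g ⋆ h = move_left (@beta a c) (g ⋆ h).
Proof.
apply/(heq_eq (X := (tight a)^~ c)).
exact: (phi_move_left (l := [::]) (phi := fun s g => @pre _ a a' s c g h)
  (@pre_beta_heq a a' h c)).
Qed.

Lemma move_right_pre a a' (h : tight a [::] a') c s p x q
    (g : tight a' (p ++ x :: s ++ q) c) :
  move_right (@beta a' c) g ⋆ h = move_right (@beta a c) (g ⋆ h).
Proof.
apply/(heq_eq (X := (tight a)^~ c)).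
exact: (phi_move_right (l := [::]) (phi := fun s g => @pre _ a a' s c g h)
  (@pre_beta_heq a a' h c)).
Qed.

Lemma beta_bijective :
  (forall x a b, is_iso (C := tight_category M) (σ x a b)) ->
  forall a c p x y q, bijective (@beta a c p x y q).
Proof.
move=> σ_iso a c p; elim: p a => [|z p IH] a x y q.
  have [τ [τσ στ]] := σ_iso a y x.
  exists (fun g => expand E (expand E (bundle E (bundle E g) ⋆ τ))) => g.
    rewrite -(bundleK E g) -(bundleK E (bundle E g)) (beta_head gen) !expandK.
    by rewrite pre_pre [tight_comp _ _]στ pre_id.
  rewrite (beta_head gen) pre_pre [tight_comp _ _]τσ pre_id.
  by rewrite !bundleK.
have [τ τK Kτ] := IH (a ⊗ z) x y q.
exists (fun g => expand E (τ (bundle E g))) => g.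
  by rewrite -(bundleK E g) (beta_cons gen) expandK τK.
by rewrite (beta_cons gen) Kτ bundleK.
Qed.

Local Notation "f ∙ g" := (tight_comp f g) (at level 40, left associativity).

(** * Consequences of the axioms (B1) to (B4) *)

Hypothesis σ_B1 : forall x a b c,
  σ (x ⊗ c) a b ∙ (σ x a c ⊠ tid b) ∙ σ (x ⊗ a) b c =
  (σ x b c ⊠ tid a) ∙ σ (x ⊗ b) a c ∙ (σ x a b ⊠ tid c).
Hypothesis σ_B2 : forall x a b c,
  σ x a (b ⊗ c) ∙ α (x ⊗ a) b c =
  (α x b c ⊠ tid a) ∙ σ (x ⊗ b) a c ∙ (σ x a b ⊠ tid c).
Hypothesis σ_B3 : forall x a b c,
  σ x (a ⊗ b) c ∙ (α x a b ⊠ tid c) =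
  α (x ⊗ c) a b ∙ (σ x a c ⊠ tid b) ∙ σ (x ⊗ a) b c.
Hypothesis σ_B4 : forall x a b c,
  (tid x ⊠ σ a b c) ∙ α x (a ⊗ b) c ∙ (α x a b ⊠ tid c) =
  α x (a ⊗ c) b ∙ (α x a c ⊠ tid b) ∙ σ (x ⊗ a) b c.

(** At the head one of the two operators is precomposition with [σ] and the other acts past it, so
    they commute by [beta_pre]. *)
Lemma beta_far a c p x y q z w r
    (g : tight a (p ++ x :: y :: q ++ z :: w :: r) c) :
  beta (q := q ++ w :: z :: r) (swap_after (@beta a c) (r := x :: y :: q) g) =
  swap_after (@beta a c) (r := y :: x :: q) (beta g).
Proof.
elim: p a g => [|v p IH] a g.
  rewrite /swap_after !(swap_along_id _ (p := _ :: _ :: q)).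
  rewrite -(bundleK E g) -(bundleK E (bundle E g)) !(beta_cons gen).
  by rewrite !(beta_head gen) !(beta_cons gen) beta_pre.
rewrite -(bundleK E g) (beta_cons gen) /swap_after.
rewrite (expand_swap_along (p := p ++ x :: y :: q) (catA p _ _) (catA p _ _)).
rewrite (expand_swap_along (p := p ++ y :: x :: q) (catA p _ _) (catA p _ _)).
by rewrite (beta_cons gen) [beta _]IH.
Qed.

Lemma beta_braid a c p x y z q (g : tight a (p ++ x :: y :: z :: q) c) :
  beta (swap_after (@beta a c) (r := [:: y]) (beta g)) =
  swap_after (@beta a c) (r := [:: z])
    (beta (swap_after (@beta a c) (r := [:: x]) g)).
Proof.
elim: p a g => [|v p IH] a g.
  rewrite /swap_after !(swap_along_id _ (p := [:: _])).
  rewrite -(bundleK E g) -(bundleK E (bundle E g)).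
  rewrite -(bundleK E (bundle E (bundle E g))).
  rewrite !(beta_head gen, beta_cons gen, expand_pre).
  (* Each side is now precomposition with a composite of three swaps, and (B1) equates the
     composites. *)
  by rewrite !pre_pre -!tight_comp_assoc σ_B1.
rewrite -(bundleK E g) (beta_cons gen) /swap_after.
rewrite !(expand_swap_along (p := p ++ [:: _]) (catA p _ _) (catA p _ _)).
rewrite !(beta_cons gen).
rewrite !(expand_swap_along (p := p ++ [:: _]) (catA p _ _) (catA p _ _)).
by congr expand; exact: IH.
Qed.

(** Moving [x] leftwards past all sources of [f] but the first one, [d], leaves
    a single swap of [x] with [d]. *)
Lemma swap_slide_left s a b d x q c (f : tight d s b)
    (g : tight (a ⊗ b ⊗ x) q c) (n : tight (a ⊗ d ⊗ x) (s ++ q) c) :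
  expand E n = move_left (@beta (a ⊗ d) c) (p := [::]) (s := s) (q := q)
                 (tsub_head (expand E g) (slide E a f)) ->
  (tsub_head (g ⋆ σ a x b) (slide E (a ⊗ x) f)
     : tight (a ⊗ x ⊗ d) (s ++ q) c) =
  n ⋆ σ a x d.
Proof.
elim: s d f g n => [|z s IH] d f g n.
  rewrite /= -[tsub_head _ _]/(expand E g ⋆ (tid a ⊠ f)) expand_pre.
  move=> /expand_inj ->; rewrite -[LHS]/(g ⋆ σ a x b ⋆ (tid (a ⊗ x) ⊠ f)).
  rewrite !pre_pre (σ_nat (tid a) (tid x) f); congr (_ ⋆ (_ ∙ _)).
  by congr (_ ⊠ _); exact: esym (tensm_id A a x).
rewrite -(bundleK E f) !slide_expand !head_expand /= !cast_id.
set k := tsub_head (expand E g) _.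
have -> : k = (tsub_head (expand E g) (slide E a (bundle E f))
    : tight _ (s ++ x :: q) c) ⋆ α a d z.
  exact: head_pre.
rewrite (expand_move_left (p := [::])) -move_left_pre.
set ml := move_left _ _; rewrite -(bundleK E ml) expand_pre.
rewrite (beta_head gen) => /expand_inj ->; rewrite expand_pre; congr expand.
rewrite [LHS]head_pre (IH _ _ _ (bundle E ml)) ?bundleK //.
by rewrite !pre_pre -!tight_comp_assoc σ_B2.
Qed.

(** Dual to [swap_slide_left]: the swap of [x] with the first source [d] comes first, the word moves
    [x] past the others, and each step of the induction is (B3). *)
Lemma swap_slide_right s a b d x q c (f : tight d s b)
    (g : tight (a ⊗ x ⊗ b) q c) :
  tsub_head (expand E (g ⋆ σ a b x)) (slide E a f) =
  move_right (@beta (a ⊗ d) c) (p := [::]) (s := s) (x := x) (q := q)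
    (expand E ((tsub_head g (slide E (a ⊗ x) f)
                  : tight (a ⊗ x ⊗ d) (s ++ q) c) ⋆ σ a d x)).
Proof.
elim: s d f g => [|z s IH] d f g.
  rewrite /= -[LHS]/(expand E (g ⋆ σ a b x) ⋆ (tid a ⊠ f)) expand_pre.
  congr expand; rewrite -[in RHS]/(g ⋆ (tid (a ⊗ x) ⊠ f)) !pre_pre.
  congr (_ ⋆ _); rewrite -(σ_nat (tid a) f (tid x)); congr (_ ∙ _).
  by congr (_ ⊠ _); exact: (tensm_id A a x).
rewrite -(bundleK E f) !slide_expand !head_expand /= !cast_id.
rewrite [tsub_head _ _](head_pre (expand E (g ⋆ σ a b x)) (slide E a (bundle E f))).
rewrite IH expand_pre.
rewrite [tsub_head g (_ ⋆ _)](head_pre g (slide E (a ⊗ x) (bundle E f))).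
rewrite (beta_head gen) (expand_move_right (p := [::])).
rewrite [_ ⋆ α a d z](move_right_pre (α a d z) (p := [::])) expand_pre.
by rewrite !pre_pre σ_B3.
Qed.

(** At the head this is (B4); further along, [beta_pre] passes the associativity map introduced by
    [slide]. *)
Lemma slide_beta a d r x y s b (f : tight d (r ++ x :: y :: s) b) :
  slide E a (beta f) = beta (slide E a f).
Proof.
elim: r d f => [|z r IH] d f.
  rewrite -(bundleK E f) -(bundleK E (bundle E f)) (beta_head gen).
  rewrite !(slide_expand, expand_pre) (beta_head gen) slide_pre.
  by rewrite !pre_pre -!tight_comp_assoc σ_B4.
rewrite -(bundleK E f) (beta_cons gen) !slide_expand (beta_cons gen) IH.
by rewrite beta_pre.
Qed.

(** * Operators on loose multimaps and equivariance in later places *)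

Hypothesis σ_runit : forall x a,
  σ x a I ∙ runit A (x ⊗ a) = runit A x ⊠ tid a.
Hypothesis σ_runit_mid : forall x c,
  σ x I c ∙ (runit A x ⊠ tid c) = runit A (x ⊗ c).

(** The unit object takes the immovable first place, so all sources of a loose multimap become
    movable. *)
Definition loose_swaps : forall b, swaps (loose^~ b) :=
  fun b p x y q f => loosen E (beta (tighten E f)).

Lemma loose_swaps_loosen b p x y q (f : tight I (p ++ x :: y :: q) b) :
  loose_swaps (loosen E f) = loosen E (beta f).
Proof. by rewrite /loose_swaps loosenK. Qed.

Lemma beta_equiv_inner a c p b q r x y s (g : tight a (p ++ b :: q) c)
    (f : loose (r ++ x :: y :: s) b) :
  tsub_at g (loose_swaps f) = swap_inner (@beta a c) (tsub_at g f).
Proof.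
rewrite -(tightenK E f) loose_swaps_loosen; move: (tighten E f) => {}f.
elim: p a g => [|z p IH] a g.
  rewrite -(bundleK E g) !at_expand_loosen slide_beta tsub_head_beta.
  exact: swap_along_pre.
rewrite -(bundleK E g) !at_expand IH; apply: esym; exact: expand_swap_along.
Qed.

Definition tsub_after a c p r b q s (g : tight a (p ++ r ++ b :: q) c)
    (f : loose s b) : tight a (p ++ r ++ s ++ q) c :=
  sub_after (X := (tight a)^~ c) (Y := loose) (@tsub_at M a c) g f.

Lemma expand_sub_after a z c p r b q s (g : tight (a ⊗ z) (p ++ r ++ b :: q) c)
    (f : loose s b) :
  tsub_after (p := z :: p) (r := r) (expand E g) f =
  expand E (tsub_after g f).
Proof.
have h s1 s2 (e : s1 = s2) (e' : z :: s1 = z :: s2) (k : tight (a ⊗ z) s1 c) :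
    cast (X := (tight a)^~ c) e' (expand E k) =
    expand E (cast (X := (tight (a ⊗ z))^~ c) e k).
  by move: e'; case: s2 / e => e'; rewrite cast_id.
rewrite /tsub_after /sub_after (h _ _ (catA p r _)) (at_expand E (p := p ++ r)).
exact: h.
Qed.

Lemma beta_equiv_before a c p x y q b r s
    (g : tight a (p ++ x :: y :: q ++ b :: r) c) (f : loose s b) :
  tsub_after (r := y :: x :: q) (beta g) f =
  beta (q := q ++ s ++ r) (tsub_after (r := x :: y :: q) g f).
Proof.
elim: p a g => [|z p IH] a g.
  rewrite /tsub_after /sub_after !cast_id -(bundleK E g) -(bundleK E (bundle E g)).
  rewrite (beta_head gen) !(at_expand E (p := _ :: q)) !(at_expand E (p := q)).
  by rewrite (beta_head gen) at_pre.
rewrite -(bundleK E g) (beta_cons gen) !expand_sub_after IH.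
exact: esym (beta_cons gen _).
Qed.

Lemma beta_equiv_left a c p b x q s (g : tight a (p ++ b :: x :: q) c)
    (f : loose s b) :
  tsub_after (r := [:: x]) (beta g) f =
  move_left (@beta a c) (tsub_at g f).
Proof.
rewrite -(tightenK E f); move: (tighten E f) => {}f.
elim: p a g => [|z p IH] a g.
  rewrite /tsub_after /sub_after !cast_id -(bundleK E g) -(bundleK E (bundle E g)).
  rewrite (beta_head gen) (at_expand E (p := [::])) !at_expand_loosen.
  rewrite -[RHS](move_left_pre _ (p := [::])).
  set ml := move_left _ _; rewrite -[in RHS](bundleK E ml).
  rewrite expand_pre; congr expand.
  (* Since [f] is now a tight map out of [I], the one swap left over is with the unit object, and a
     unit law absorbs it. *)
  rewrite (swap_slide_left (n := bundle E ml)); last exact: bundleK.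
  by rewrite pre_pre σ_runit.
by rewrite -(bundleK E g) (beta_cons gen) expand_sub_after IH at_expand
  expand_move_left.
Qed.

Lemma beta_equiv_right a c p x b q s (g : tight a (p ++ x :: b :: q) c)
    (f : loose s b) :
  tsub_at (beta g) f =
  move_right (@beta a c) (tsub_after (r := [:: x]) g f).
Proof.
rewrite -(tightenK E f); move: (tighten E f) => {}f.
elim: p a g => [|z p IH] a g.
  rewrite /tsub_after /sub_after !cast_id -(bundleK E g) -(bundleK E (bundle E g)).
  rewrite (beta_head gen) (at_expand E (p := [::])) !at_expand_loosen.
  (* The word begins with a swap past the unit object, which the other unit law absorbs. *)
  rewrite swap_slide_right [LHS](move_right_pre _ (p := [::])).
  by rewrite expand_pre pre_pre σ_runit_mid.
by rewrite -(bundleK E g) (beta_cons gen) expand_sub_after at_expand IH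
  expand_move_right.
Qed.

Lemma beta_equiv_beyond a c p b q x y r s
    (g : tight a (p ++ b :: q ++ x :: y :: r) c) (f : loose s b) :
  tsub_at (q := q ++ y :: x :: r) (swap_after (@beta a c) (r := b :: q) g) f =
  swap_outer (@beta a c) (tsub_at g f).
Proof.
rewrite -(tightenK E f); move: (tighten E f) => {}f.
elim: p a g => [|z p IH] a g.
  rewrite /swap_after (swap_along_id _ (p := b :: q)).
  rewrite -(bundleK E g) (beta_cons gen) !at_expand_loosen beta_tsub_head.
  exact: swap_along_pre.
rewrite -(bundleK E g) /swap_after.
rewrite (expand_swap_along (p := p ++ b :: q) (catA p _ _) (catA p _ _)).
rewrite !at_expand [tsub_at _ _]IH; apply: esym; exact: expand_swap_along.
Qed.

Lemma beta_equivariant a c :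
  equivariant (@beta a c) loose_swaps (@tsub_at M a c).
Proof.
split=> *; [exact: beta_equiv_inner | exact: beta_equiv_before |
  exact: beta_equiv_left | exact: beta_equiv_right | exact: beta_equiv_beyond].
Qed.

Lemma forget_beta a b p x y q (g : tight a (p ++ x :: y :: q) b) :
  forget (beta g) = loose_swaps (p := a :: p) (forget g).
Proof.
(* Forgetting factors into a precomposition, an expansion and a loosening, each compatible with the
   operators; the expansion accounts for the prefix [a :: p]. *)
have h s (k : tight a s b) : loosen E (expand E (k ⋆ bundle E (unitor E a))) =
    forget k.
  rewrite -(loosen_unitor E) -[in RHS](bundleK E (unitor E a)); congr loosen.
  exact: esym (head_expand E (s := [::]) k _).
by rewrite -!h (loose_swaps_loosen (p := a :: p)) (beta_cons gen) beta_pre.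
Qed.

Lemma loosen_beta_heq c p x y q (g : tight I (p ++ x :: y :: q) c)
    (g' : loose (([::] ++ p) ++ x :: y :: q) c) :
  heq (X := loose^~ c) (loosen E g : loose ([::] ++ _) c) g' ->
  heq (X := loose^~ c) (loosen E (beta g) : loose ([::] ++ _) c)
    (loose_swaps g').
Proof.
move=> e; have {}e : loosen E g = g' by exact: (heq_eq (X := loose^~ c)).
by rewrite -[g']e loose_swaps_loosen.
Qed.

Lemma loosen_swap_along c s1 s2 p x y q (e1 e1' : s1 = p ++ x :: y :: q)
    (e2 e2' : s2 = p ++ y :: x :: q) (g : tight I s1 c) :
  loosen E (swap_along (@beta I c) e1 e2 g) =
  swap_along (@loose_swaps c) e1' e2' (loosen E g).
Proof.
apply/(heq_eq (X := loose^~ c)).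
exact: (phi_swap_along (l := [::]) (phi := fun s => @loosen _ _ E s c)
  (@loosen_beta_heq c)).
Qed.

Lemma loosen_move_left c s p x q (g : tight I (p ++ s ++ x :: q) c) :
  loosen E (move_left (@beta I c) g) = move_left (@loose_swaps c) (loosen E g).
Proof.
apply/(heq_eq (X := loose^~ c)).
exact: (phi_move_left (l := [::]) (phi := fun s => @loosen _ _ E s c)
  (@loosen_beta_heq c)).
Qed.

Lemma loosen_move_right c s p x q (g : tight I (p ++ x :: s ++ q) c) :
  loosen E (move_right (@beta I c) g) = move_right (@loose_swaps c) (loosen E g).
Proof.
apply/(heq_eq (X := loose^~ c)).
exact: (phi_move_right (l := [::]) (phi := fun s => @loosen _ _ E s c)
  (@loosen_beta_heq c)).
Qed.

Lemma loosen_sub_after c p r b q s (g : tight I (p ++ r ++ b :: q) c)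
    (f : loose s b) :
  sub_after (X := loose^~ c) (Y := loose) (@lsub_at M c) (r := r) (loosen E g) f =
  loosen E (tsub_after g f).
Proof.
have h s1 s2 (e : s1 = s2) (k : tight I s1 c) :
    cast (X := loose^~ c) e (loosen E k) =
    loosen E (cast (X := (tight I)^~ c) e k).
  by case: s2 / e.
rewrite /tsub_after /sub_after h -(loosen_at E (p := p ++ r)); exact: h.
Qed.

Hypothesis σ_iso :
  forall x a b, is_iso (C := tight_category M) (σ x a b).

Lemma beta_action a c : braid_action (@beta a c).
Proof.
by split=> *; [exact: beta_bijective | exact: beta_far | exact: beta_braid].
Qed.

Lemma loose_swaps_action c : braid_action (@loose_swaps c).
Proof.
split=> [p x y q|p x y q z w r g|p x y z q g].
- have [τ τK Kτ] := beta_bijective σ_iso I c p x y q.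
  exists (fun g => loosen E (τ (tighten E g))) => g.
    by rewrite /loose_swaps loosenK τK tightenK.
  by rewrite /loose_swaps loosenK Kτ tightenK.
- rewrite -(tightenK E g); move: (tighten E g) => {}g.
  rewrite /swap_after -(loosen_swap_along (catA p (x :: y :: q) _) _ (catA p _ _) _).
  rewrite !loose_swaps_loosen [beta _]beta_far.
  exact: loosen_swap_along.
rewrite -(tightenK E g); move: (tighten E g) => {}g.
rewrite loose_swaps_loosen /swap_after.
rewrite -!(loosen_swap_along (p := p ++ [:: _]) (catA p _ _) _ (catA p _ _) _).
by rewrite !loose_swaps_loosen [beta _]beta_braid loosenK.
Qed.

(** Every loose [g] is the loosening of a tight map out of [I], and loosening commutes with swaps
    and substitution, so the tight case suffices. *)
Lemma loose_swaps_equivariant c :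
  equivariant (@loose_swaps c) loose_swaps (@lsub_at M c).
Proof.
split=> [p b q r x y s g f|p x y q b r s g f|p b x q s g f|p x b q s g f|
    p b q x y r s g f]; rewrite -(tightenK E g); move: (tighten E g) => {}g.
- by rewrite -!loosen_at beta_equiv_inner; exact: loosen_swap_along.
- rewrite loose_swaps_loosen !loosen_sub_after beta_equiv_before.
  exact: esym (loose_swaps_loosen _).
- by rewrite loose_swaps_loosen loosen_sub_after beta_equiv_left -loosen_at
    loosen_move_left.
- by rewrite loose_swaps_loosen loosen_sub_after -loosen_at beta_equiv_right
    loosen_move_right.
rewrite /swap_after -(loosen_swap_along (p := p ++ b :: q) (catA p _ _) _
  (catA p _ _) _).
rewrite -!loosen_at [tsub_at _ _]beta_equiv_beyond.
exact: loosen_swap_along.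
Qed.

Definition generated_braiding : braiding M :=
  Braiding loose_swaps_action beta_action forget_beta loose_swaps_equivariant
    beta_equivariant tsub_head_beta beta_tsub_head.

End Generated.
End TightSwaps.

(** * From operators on multimaps to a braiding on the category *)

Section InducedSwap.
Variables (M : skew_multicategory) (A : skew_monoidal (tight_category M)).
Variables (E : tight_correspondence A) (β : braiding M).
Implicit Types (a b c d x y z : mob M) (p q r s : seq (mob M)).

Local Notation "a ⊗ b" := (tens A a b) (at level 38, left associativity).
Local Notation "f ⊠ g" := (tensm A f g) (at level 38, left associativity).
Local Notation "g ⋆ f" := (pre g f) (at level 40, left associativity).
Local Notation "f ∙ g" := (tight_comp f g) (at level 40, left associativity).
Local Notation I := (unit_ob A : mob M).
Local Notation α := (assoc A).

(** As in the Yoneda lemma, the operator is evaluated at the universal ternary map, the expansion of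
    an identity. *)
Definition induced_swap : swap_family A := fun x a b =>
  bundle E (bundle E
    (tbeta β (p := [::]) (expand E (expand E (tid (x ⊗ b ⊗ a)))))).
Local Notation σ := induced_swap.

(** The head clause holds because each double expansion is a first-place substitution of the
    universal ternary map, with which [tbeta_head_inner] is compatible. The other clause is
    [tbeta_head_beyond] along a universal binary map. *)
Lemma tbeta_generated : generated E σ (tbeta β).
Proof.
split=> [a x y q c g|a z p x y q c g]; last first.
  rewrite -[LHS](swap_along_id _ (p := z :: p) (catA [:: z] p _) (catA [:: z] p _)).
  exact: esym (tbeta_head_beyond β g (tens_map E a z)).
have h b (k : tight b [::] (a ⊗ x ⊗ y)) :
    tsub_head g (k : tight _ [::] _) = g ⋆ k by [].
have e : expand E (expand E g) =
    tsub_head g (expand E (expand E (tid (a ⊗ x ⊗ y)))) :> tight a (x :: y :: q) c.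
  by rewrite (head_expand E (s := [:: y])) (head_expand E (s := [::])) h pre_id.
have := tbeta_head_inner β (r := [::]) (s := [::]) g
  (expand E (expand E (tid (a ⊗ x ⊗ y)))).
rewrite /swap_inner (swap_along_id _ (p := [::]) (q := q)) -e => <-.
pose t : tight a [:: y; x] (a ⊗ x ⊗ y) :=
  tbeta β (p := [::]) (expand E (expand E (tid (a ⊗ x ⊗ y)))).
rewrite -[tbeta β _]/t -(bundleK E t) -(bundleK E (bundle E t)).
by rewrite (head_expand E (s := [:: x])) (head_expand E (s := [::])).
Qed.

Lemma expand_expand_inj a x y q c (g g' : tight (a ⊗ x ⊗ y) q c) :
  expand E (expand E g) = expand E (expand E g') -> g = g'.
Proof. by move=> /expand_inj /expand_inj. Qed.

Lemma tid_pre a b (f : tight a [::] b) : tid b ⋆ f = f.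
Proof. by rewrite preE tight_comp_idl. Qed.

(** Naturality in each variable is equivariance for a unary multimap: in the first place here, and
    in one of the two swapped places for [swap_nat2] and [swap_nat3]. *)
Lemma swap_nat1 x x' a b (h : tight x [::] x') :
  (h ⊠ tid b ⊠ tid a) ∙ σ x a b = σ x' a b ∙ (h ⊠ tid a ⊠ tid b).
Proof.
have := tbeta_head_beyond β (q := [::])
  (expand E (expand E (tid (x' ⊗ b ⊗ a)))) h.
rewrite /swap_after (swap_along_id _ (p := [::])) (beta_head tbeta_generated).
rewrite -![tsub_head _ h]/(_ ⋆ h) !expand_pre (beta_head tbeta_generated).
by move=> /expand_expand_inj; rewrite !tid_pre !preE => <-.
Qed.

Lemma swap_nat2 x a a' b (h : tight a [::] a') :
  (tid (x ⊗ b) ⊠ h) ∙ σ x a b = σ x a' b ∙ (tid x ⊠ h ⊠ tid b).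
Proof.
have := equiv_right (tbeta_equivariant β x _) (p := [::]) (s := [:: a])
  (expand E (expand E (tid (x ⊗ b ⊗ a')))) (forget h).
rewrite /sub_after /= !cast_id (beta_head tbeta_generated).
rewrite (at_expand E (p := [::])) !(at_expand_unary E) expand_pre.
rewrite (beta_head tbeta_generated).
by move=> /expand_expand_inj; rewrite !tid_pre !preE => <-.
Qed.

Lemma swap_nat3 x a b b' (h : tight b [::] b') :
  (tid x ⊠ h ⊠ tid a) ∙ σ x a b = σ x a b' ∙ (tid (x ⊗ a) ⊠ h).
Proof.
have := equiv_left (tbeta_equivariant β x _) (p := [::]) (s := [:: b])
  (expand E (expand E (tid (x ⊗ b' ⊗ a)))) (forget h).
rewrite /sub_after /= !cast_id (beta_head tbeta_generated).
rewrite (at_expand E (p := [::])) !(at_expand_unary E) expand_pre.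
rewrite (beta_head tbeta_generated).
by move=> /expand_expand_inj; rewrite !tid_pre !preE => <-.
Qed.

Lemma induced_swap_nat x x' a a' b b' (f : tight x [::] x')
    (g : tight a [::] a') (h : tight b [::] b') :
  (f ⊠ h ⊠ g) ∙ σ x a b = σ x' a' b' ∙ (f ⊠ g ⊠ h).
Proof.
have tens_comp a1 a2 a3 b1 b2 b3 (f2 : tight a2 [::] a3) (f1 : tight a1 [::] a2)
    (g2 : tight b2 [::] b3) (g1 : tight b1 [::] b2) :
    (f2 ⊠ g2) ∙ (f1 ⊠ g1) = (f2 ∙ f1) ⊠ (g2 ∙ g1).
  exact: esym (tensm_comp A f2 f1 g2 g1).
have dec a1 a2 b1 b2 c1 c2 (f' : tight a1 [::] a2) (g' : tight b1 [::] b2)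
    (h' : tight c1 [::] c2) :
    f' ⊠ g' ⊠ h' = (f' ⊠ tid b2 ⊠ tid c2) ∙ (tid a1 ⊠ g' ⊠ tid c2) ∙
      (tid (a1 ⊗ b1) ⊠ h').
  by rewrite !(tens_comp, tight_comp_idl, tight_comp_idr).
(* The last two factors act in the opposite order to [dec], because [σ] exchanges their
   positions. *)
have dec' : f ⊠ h ⊠ g = (f ⊠ tid b' ⊠ tid a') ∙ (tid (x ⊗ b') ⊠ g) ∙
      (tid x ⊠ h ⊠ tid a).
  by rewrite !(tens_comp, tight_comp_idl, tight_comp_idr).
rewrite dec' [f ⊠ g ⊠ h]dec !tight_comp_assoc swap_nat3 -(tight_comp_assoc _ (σ _ _ _)).
by rewrite swap_nat2 -!tight_comp_assoc swap_nat1.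
Qed.

Lemma induced_swap_invertible x a b : is_iso (C := tight_category M) (σ x a b).
Proof.
have [τ τK Kτ] := swap_bijective (tbeta_action β x (x ⊗ a ⊗ b)) [::] b a [::].
pose t := bundle E (bundle E (τ (expand E (expand E (tid (x ⊗ a ⊗ b)))))).
have ts : t ∙ σ x a b = tid _.
  rewrite -preE; apply: expand_expand_inj.
  by rewrite -(beta_head tbeta_generated) !bundleK Kτ.
exists t; split; first exact: ts.
(* Precomposition with [σ] is injective because the operator is, so the left inverse [t] is also a
   right inverse. *)
suff : σ x a b ∙ t ∙ σ x a b = tid _ ∙ σ x a b.
  rewrite -!preE => e.
  have {e} := congr1 (fun g => expand E (expand E g)) e.
  rewrite -!(beta_head tbeta_generated).
  have inj := bij_inj (swap_bijective (tbeta_action β x (x ⊗ b ⊗ a)) [::] b a [::]).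
  by move=> /inj /expand_expand_inj => e; apply: etrans (esym (preE _ _)) e.
by rewrite tight_comp_assoc ts tight_comp_idl tight_comp_idr.
Qed.

(** The braid relation evaluated at an expanded identity; injectivity of expansion turns it into an
    equation of unary maps. The other axioms follow likewise from equivariance. *)
Lemma induced_swap_B1 x a b c :
  σ (x ⊗ c) a b ∙ (σ x a c ⊠ tid b) ∙ σ (x ⊗ a) b c =
  (σ x b c ⊠ tid a) ∙ σ (x ⊗ b) a c ∙ (σ x a b ⊠ tid c).
Proof.
have := swap_braid (tbeta_action β x _) (p := [::]) (q := [::])
  (expand E (expand E (expand E (tid (x ⊗ c ⊗ b ⊗ a))))).
rewrite /swap_after !(swap_along_id _ (p := [:: _])).
rewrite !(beta_head tbeta_generated, beta_cons tbeta_generated, expand_pre).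
by move=> /expand_inj /expand_expand_inj; rewrite !tid_pre !preE => ->.
Qed.

(** [equiv_left] for the universal map [b, c -> bc], whose word consists of two swaps. *)
Lemma induced_swap_B2 x a b c :
  σ x a (b ⊗ c) ∙ α (x ⊗ a) b c =
  (α x b c ⊠ tid a) ∙ σ (x ⊗ b) a c ∙ (σ x a b ⊠ tid c).
Proof.
have := equiv_left (tbeta_equivariant β x _) (p := [::]) (s := [:: b; c])
  (q := [::]) (expand E (expand E (tid (x ⊗ (b ⊗ c) ⊗ a)))) (forget (tens_map E b c)).
rewrite /sub_after /= !cast_id (beta_head tbeta_generated).
rewrite (at_expand E (p := [::])) !(at_expand_tens E) !expand_pre.
rewrite !(beta_head tbeta_generated, beta_cons tbeta_generated, expand_pre).
by move=> /expand_inj /expand_expand_inj; rewrite !tid_pre !preE => ->.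
Qed.

Lemma induced_swap_B3 x a b c :
  σ x (a ⊗ b) c ∙ (α x a b ⊠ tid c) =
  α (x ⊗ c) a b ∙ (σ x a c ⊠ tid b) ∙ σ (x ⊗ a) b c.
Proof.
have := equiv_right (tbeta_equivariant β x _) (p := [::]) (s := [:: a; b])
  (q := [::]) (expand E (expand E (tid (x ⊗ c ⊗ (a ⊗ b))))) (forget (tens_map E a b)).
rewrite /sub_after /= !cast_id (beta_head tbeta_generated).
rewrite (at_expand E (p := [::])) !(at_expand_tens E) !expand_pre.
rewrite !(beta_head tbeta_generated, beta_cons tbeta_generated, expand_pre).
by move=> /expand_inj /expand_expand_inj; rewrite !tid_pre !preE => ->.
Qed.

(** [equiv_inner] for the universal ternary map out of [a, c, b], with its last two sources
    swapped. *)
Lemma induced_swap_B4 x a b c :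
  (tid x ⊠ σ a b c) ∙ α x (a ⊗ b) c ∙ (α x a b ⊠ tid c) =
  α x (a ⊗ c) b ∙ (α x a c ⊠ tid b) ∙ σ (x ⊗ a) b c.
Proof.
have := equiv_inner (tbeta_equivariant β x _) (p := [::]) (q := [::])
  (r := [:: a]) (s := [::]) (expand E (tid (x ⊗ (a ⊗ c ⊗ b))))
  (forget (expand E (expand E (tid (a ⊗ c ⊗ b))))).
rewrite -(forget_tbeta β (p := [::])) (beta_head tbeta_generated).
rewrite !at_expand_forget /swap_inner (swap_along_id _ (p := [:: a]) (q := [::])).
rewrite !slide_expand !expand_pre.
rewrite !(head_expand E (s := [:: _])) !(head_expand E (s := [::])) /=.
rewrite (beta_cons tbeta_generated) (beta_head tbeta_generated).
move=> /expand_inj /expand_expand_inj.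
rewrite -![tsub_head (tid _) _]/(tid _ ⋆ _) [tid x ⊠ tid _](tensm_id A).
by rewrite !tid_pre !preE.
Qed.

Definition induced_swap_iso : swap_iso A :=
  @SwapIso (tight_category M) A induced_swap induced_swap_nat induced_swap_invertible.

Definition induced_braiding : skew_braiding A :=
  @SkewBraiding (tight_category M) A induced_swap_iso induced_swap_B1
    induced_swap_B2 induced_swap_B3 induced_swap_B4.

Lemma induces_generated (s : swap_iso A) :
  induces E β s -> generated E s (tbeta β).
Proof.
move=> h; split=> [a x y q c g|]; last exact: (beta_cons tbeta_generated).
rewrite (beta_head tbeta_generated); congr (expand _ (expand _ (_ ⋆ _))).
apply: expand_expand_inj; have /= := h a y x _ (tid _).
rewrite -![tsub_head _ (tens_map E _ _)]/(expand E _) (beta_head tbeta_generated).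
by rewrite tight_comp_idl tid_pre => ->.
Qed.

Lemma induces_induced_swap : induces E β induced_swap_iso.
Proof.
move=> a b c d h /=; rewrite -![tsub_head _ (tens_map E _ _)]/(expand E _).
by rewrite (beta_head tbeta_generated) preE.
Qed.

Lemma generated_head (s : swap_family A) : generated E s (tbeta β) ->
  forall x a b, s x a b = σ x a b.
Proof.
move=> gen x a b; apply: expand_expand_inj.
rewrite -[s x a b]tid_pre -[σ x a b]tid_pre -(beta_head gen).
by rewrite (beta_head tbeta_generated).
Qed.

(** [loosen] is substitution of the universal nullary map into the first place,
    so [equiv_beyond] transports the operators from tight to loose multimaps. *)
Lemma lbeta_loosen c p x y q (g : tight I (p ++ x :: y :: q) c) :
  lbeta β (loosen E g) = loosen E (tbeta β g).
Proof.
have := equiv_beyond (lbeta_equivariant β c) (p := [::]) (q := p) (b := I)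
  (forget g) (unit_map E).
rewrite /swap_after (swap_along_id _ (p := I :: p)) -forget_tbeta.
by rewrite /swap_outer (swap_along_id _ (p := p)).
Qed.

(** Two swaps at the head amount to precomposition with a double [σ]; other positions reduce to the
    head by absorbing sources, and loose multimaps to tight ones by [lbeta_loosen]. *)
Lemma symmetry_iff :
  is_symmetry β <-> forall x a b, σ x b a ∙ σ x a b = tid (x ⊗ a ⊗ b).
Proof.
have sq a x y q c (g : tight (a ⊗ x ⊗ y) q c) :
    tbeta β (p := [::]) (tbeta β (p := [::]) (expand E (expand E g))) =
    expand E (expand E (g ⋆ (σ a y x ∙ σ a x y))).
  by rewrite !(beta_head tbeta_generated) pre_pre.
split=> [[_ symm] x a b|symm].
  apply: expand_expand_inj; rewrite -[_ ∙ _]tid_pre -sq.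
  exact: (symm x _ [::] a b [::]).
have tsymm a c p x y q (g : tight a (p ++ x :: y :: q) c) :
    tbeta β (tbeta β g) = g.
  elim: p a g => [|z p IH] a g.
    by rewrite -(bundleK E g) -(bundleK E (bundle E g)) sq symm pre_id.
  by rewrite -(bundleK E g) !(beta_cons tbeta_generated) IH.
split=> [c p x y q g|a c p x y q g]; last exact: tsymm.
by rewrite -(tightenK E g) !lbeta_loosen tsymm.
Qed.

End InducedSwap.

(** * The two constructions are mutually inverse *)

Section Extensionality.
Variables (M : skew_multicategory) (A : skew_monoidal (tight_category M)).
Variable E : tight_correspondence A.

Lemma swap_iso_ext (s s' : swap_iso A) :
  (forall x a b, s x a b = s' x a b) -> s = s'.
Proof.
case: s s' => [f fn fi] [f' fn' fi'] /= e.
have {}e : f = f'.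
  do 3!apply: functional_extensionality_dep => ?; exact: e.
rewrite e in fn fi *; congr SwapIso; exact: proof_irrelevance.
Qed.

Lemma skew_braiding_ext (s s' : skew_braiding A) :
  (forall x a b, s x a b = s' x a b) -> s = s'.
Proof.
case: s s' => [f b1 b2 b3 b4] [f' b1' b2' b3' b4'] /= /swap_iso_ext e.
rewrite e in b1 b2 b3 b4 *; congr SkewBraiding; exact: proof_irrelevance.
Qed.

(** The tight operators are generated by the induced swap and determine the loose ones; the
    remaining fields are propositions. *)
Lemma braiding_ext (β β' : braiding M) :
  (forall x a b, induced_swap E β x a b = induced_swap E β' x a b) -> β = β'.
Proof.
move=> e.
have gen : generated E (induced_swap E β) (tbeta β') .
  split=> *; last exact: (beta_cons (tbeta_generated E β')).
  by rewrite (beta_head (tbeta_generated E β')) e.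
have et a c p x y q (g : tight a (p ++ x :: y :: q) c) :
    tbeta β g = tbeta β' g.
  exact: generated_unique (tbeta_generated E β) gen _ _ _ _ _ _ _.
have el c p x y q (g : loose (p ++ x :: y :: q) c) : lbeta β g = lbeta β' g.
  by rewrite -(tightenK E g) !lbeta_loosen et.
case: β β' e gen et el => [l t a1 a2 a3 a4 a5 a6 a7] [l' t' b1 b2 b3 b4 b5 b6 b7].
move=> /= _ _ et el.
have {}et : t = t'.
  do 7!apply: functional_extensionality_dep => ?; exact: et.
have {}el : l = l'.
  do 6!apply: functional_extensionality_dep => ?; exact: el.
rewrite et el in a1 a2 a3 a4 a5 a6 a7 *.
congr Braiding; exact: proof_irrelevance.
Qed.

Definition braiding_of (s : skew_braiding A) : braiding M :=
  generated_braiding (swaps_of_generated E s) (@swap_nat _ _ s)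
    (@skew_B1 _ _ s) (@skew_B2 _ _ s) (@skew_B3 _ _ s) (@skew_B4 _ _ s)
    (braiding_runit s) (braiding_runit_mid s) (@swap_invertible _ _ s).

Lemma induced_braidingK : cancel (induced_braiding E) braiding_of.
Proof.
move=> β; apply: braiding_ext => x a b; apply: esym.
by apply: generated_head; apply: swaps_of_generated.
Qed.

Lemma braiding_ofK : cancel braiding_of (induced_braiding E).
Proof.
move=> s; apply: skew_braiding_ext => x a b; apply: esym.
by apply: generated_head; apply: swaps_of_generated.
Qed.

End Extensionality.

(** * The bijection of braidings and its restriction to symmetries *)

Theorem theorem5p5 (M : skew_multicategory) (HM : left_representable M)
    (A : skew_monoidal (tight_category M)) (E : tight_correspondence A) :
  (forall beta : braiding M, exists! s : swap_iso A, induces E beta s) /\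
  exists Phi : braiding M -> skew_braiding A,
    [/\ forall beta : braiding M, induces E beta (Phi beta),
        bijective Phi
      & exists Psi : symmetry M -> skew_symmetry A,
          (forall beta : symmetry M, sval (Psi beta) = Phi (sval beta)) /\
          bijective Psi].
Proof.
split=> [β|].
  exists (induced_swap_iso E β); split; first exact: induces_induced_swap.
  move=> s /induces_generated gen; apply: swap_iso_ext => x a b.
  exact/esym/(generated_head gen).
exists (induced_braiding E); split.
- by move=> β; apply: induces_induced_swap.
- exact: Bijective (induced_braidingK E) (braiding_ofK E).
have sig_ext T (P : T -> Prop) (u v : {x | P x}) : sval u = sval v -> u = v.
  by case: u v => [u Pu] [v Pv] /= e; case: v / e Pv => Pv; congr exist;
    exact: proof_irrelevance.
have to_sym (β : symmetry M) : is_skew_symmetry (induced_braiding E (sval β)).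
  by case: β => β /= /(symmetry_iff E).
have of_sym (s : skew_symmetry A) : is_symmetry (braiding_of E (sval s)).
  case: s => s /= symm; apply/(symmetry_iff E) => x a b.
  (* The identity is written as a double swap of [s], and [s] is the swap induced by its own
     braiding. *)
  by rewrite -[RHS]symm -[s in RHS](braiding_ofK E).
exists (fun β => exist _ _ (to_sym β)); split=> //.
exists (fun s => exist _ _ (of_sym s)) => [β|s]; apply: sig_ext.
  exact: induced_braidingK.
exact: braiding_ofK.
Qed.
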